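(* Let $k$ be a field, $n\ge 1$ an integer, $A_n=k[x_1,\ldots,x_n]_{(x_1,\ldots,x_n)}$ and $R_n=\mathcal T(A_n)$. Regard $k$ as an $R_n$-module through $R_n\to A_n\to k$. Then, for $1\le i\le n$, $$\mathrm{Tor}_i^{R_n}(k,k)\cong k^{\binom ni}.$$ In particular $\mathrm{fd}_{R_n}k=n$ for $n\geq 1$.
   Context: All rings are commutative with identity. For a nonzero local ring $(A,\mathfrak m)$ with residue field $\kappa=A/\mathfrak m$ and residue map $a\mapsto\bar a$, define the ring, with coordinatewise operations, $$\mathcal T(A)=\{(a,(c_i)_{i\in\mathbb N})\in A\times\kappa^{\mathbb N}: c_i=\bar a\text{ for all but finitely many }i\},\quad \mathbb N=\{1,2,\ldots\}.$$ The map $R_n\to A_n$ is the projection $(a,(c_i))\mapsto a$, and $A_n\to k$ is reduction modulo the maximal ideal $(x_1,\ldots,x_n)$. $\mathrm{fd}$ denotes flat dimension (least length of a flat resolution). *)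

(* Defs.v *)
From HB Require Import structures.
From mathcomp Require Import all_boot all_algebra.
From mathcomp Require Import boolp classical_sets functions cardinality.
From mathcomp Require Import freeg mpoly.

Set Implicit Arguments.
Unset Strict Implicit.
Unset Printing Implicit Defensive.

Import GRing.Theory.

Local Open Scope ring_scope.
Local Open Scope quotient_scope.

Section Submodule.
Variables (R : comNzRingType) (V : lmodType R) (S : submodClosed V).

Record submod : Type := Submod { submod_val : V; _ : submod_val \in S }.

HB.instance Definition _ := [isSub for submod_val].
HB.instance Definition _ := [Choice of submod by <:].
HB.instance Definition _ := [SubChoice_isSubLmodule of submod by <:].

Fact submod_zmod_closed : zmod_closed S.
Proof.
by split=> [|u v uS vS]; rewrite ?rpred0 // -scaleN1r rpredD ?rpredZ.
Qed.

(* submodClosed does not inherit from zmodClosed in the library *)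
Definition submod_zmod : zmodClosed V :=
  HB.pack (GRing.SubmodClosed.sort S)
    (GRing.isZmodClosed.Build V (GRing.SubmodClosed.sort S) submod_zmod_closed).

(* The quotient module V / S, on top of the quotient group of ring_quotient. *)
Definition quotmod : Type := Quotient.quot submod_zmod.

HB.instance Definition _ := GRing.Zmodule.on quotmod.

Definition quotmod_pi (v : V) : quotmod := \pi_(Quotient.quot submod_zmod) v.
Definition quotmod_repr (q : quotmod) : V :=
  repr (q : Quotient.quot submod_zmod).

Lemma quotmod_reprK q : quotmod_pi (quotmod_repr q) = q.
Proof. exact: reprK. Qed.

Lemma quotmod_piP u v : quotmod_pi u = quotmod_pi v <-> u - v \in S.
Proof.
split=> [/eqP|h]; first by rewrite -Quotient.idealrBE.
by apply/eqP; rewrite -Quotient.idealrBE.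
Qed.

Lemma quotmod_piD u v : quotmod_pi (u + v) = quotmod_pi u + quotmod_pi v.
Proof. exact: (raddfD (\pi_(Quotient.quot submod_zmod))). Qed.

Definition quotmod_scale (a : R) (q : quotmod) : quotmod :=
  quotmod_pi (a *: quotmod_repr q).

Lemma quotmod_scaleE a v : quotmod_scale a (quotmod_pi v) = quotmod_pi (a *: v).
Proof.
apply/quotmod_piP; rewrite -scalerBr rpredZ //.
by apply/quotmod_piP; rewrite quotmod_reprK.
Qed.

Fact quotmod_scaleA a b q :
  quotmod_scale a (quotmod_scale b q) = quotmod_scale (a * b) q.
Proof. by rewrite -[q]quotmod_reprK !quotmod_scaleE scalerA. Qed.

Fact quotmod_scale1 : left_id 1 quotmod_scale.
Proof. by move=> q; rewrite -[q]quotmod_reprK quotmod_scaleE scale1r. Qed.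

Fact quotmod_scaleDr : right_distributive quotmod_scale +%R.
Proof.
move=> a p q; rewrite -[p]quotmod_reprK -[q]quotmod_reprK.
by rewrite -quotmod_piD !quotmod_scaleE scalerDr quotmod_piD.
Qed.

Fact quotmod_scaleDl q : {morph quotmod_scale^~ q : a b / a + b}.
Proof.
move=> a b; rewrite -[q]quotmod_reprK.
by rewrite !quotmod_scaleE scalerDl quotmod_piD.
Qed.

HB.instance Definition _ := GRing.Zmodule_isLmodule.Build R quotmod
  quotmod_scaleA quotmod_scale1 quotmod_scaleDr quotmod_scaleDl.

Fact quotmod_pi_is_linear : linear quotmod_pi.
Proof. by move=> a u v; rewrite quotmod_piD -quotmod_scaleE. Qed.

HB.instance Definition _ :=
  GRing.isLinear.Build R V quotmod _ quotmod_pi quotmod_pi_is_linear.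

End Submodule.

Section Kernel.
Variables (R : comNzRingType) (U V : lmodType R) (f : {linear U -> V}).

Definition kernel : {pred U} := fun u => f u == 0.

Lemma kernelE u : (u \in kernel) = (f u == 0). Proof. by []. Qed.

Fact kernel_submod_closed : submod_closed kernel.
Proof.
split=> [|a u v]; rewrite !kernelE ?linear0 //.
by rewrite linearP => /eqP-> /eqP->; rewrite scaler0 addr0.
Qed.

HB.instance Definition _ := GRing.isSubmodClosed.Build R U kernel
  kernel_submod_closed.

End Kernel.

Section Span.
Variables (R : comNzRingType) (V : lmodType R) (G : V -> Prop).

(* The smallest submodule containing G. *)
Definition span_of : {pred V} := fun v =>
  `[< forall S : submodClosed V, (forall g, G g -> g \in S) -> v \in S >].

Fact span_of_submod_closed : submod_closed span_of.
Proof.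
split=> [|a u v]; first by apply/asboolP=> S _; rewrite rpred0.
move=> /asboolP hu /asboolP hv; apply/asboolP=> S hS.
by rewrite rpredD ?rpredZ ?hu ?hv.
Qed.

HB.instance Definition _ := GRing.isSubmodClosed.Build R V span_of
  span_of_submod_closed.

Lemma sub_span_of g : G g -> g \in span_of.
Proof. by move=> Gg; apply/asboolP=> S; apply. Qed.

End Span.

Section FreeModule.
Variables (R : comNzRingType).

Definition freemod (X : choiceType) : lmodType R := {freeg X / R}.

Variables (X : choiceType) (M : lmodType R) (f : X -> M).

(* The linear extension of f to the free module on X. *)
Definition freemod_lift : freemod X -> M := fglift f.

Lemma freemod_liftU a x : freemod_lift << a *g x >> = a *: f x.
Proof. exact: liftU. Qed.

Fact freemod_lift_is_linear : linear freemod_lift.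
Proof.
have liftB : zmod_morphism freemod_lift by exact: lift_is_additive.
have liftD u v : freemod_lift (u + v) = freemod_lift u + freemod_lift v.
  have lift0 : freemod_lift 0 = 0 by rewrite -(subrr 0) liftB subrr.
  by rewrite -[v in LHS]opprK liftB -[- v]add0r liftB lift0 sub0r opprK.
move=> a u v; rewrite liftD; congr (_ + _).
have lift_sum (s : seq X) (F : X -> freemod X) :
    freemod_lift (\sum_(z <- s) F z) = \sum_(z <- s) freemod_lift (F z).
  apply: (big_morph freemod_lift liftD).
  by rewrite -(subrr 0) liftB subrr.
have scaleU b x : a *: << b *g x >> = << a * b *g x >> :> freemod X.
  by apply/eqP/freeg_eqP => y; rewrite coeffZ !coeffU mulrA.
rewrite -[u]freeg_sumE scaler_sumr !lift_sum scaler_sumr.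
by apply: eq_bigr => z _; rewrite scaleU !freemod_liftU scalerA.
Qed.

HB.instance Definition _ :=
  GRing.isLinear.Build R (freemod X) M _ freemod_lift freemod_lift_is_linear.

End FreeModule.

Section Tensor.
Variables (R : comNzRingType).

Section Def.
Variables (M N : lmodType R).

Local Notation F := (freemod R (M * N)%type).
Local Notation e m n := (<< (m, n) >> : F).

Inductive tensor_relation : F -> Prop :=
| TensorDl m m' n : tensor_relation (e (m + m') n - e m n - e m' n)
| TensorDr m n n' : tensor_relation (e m (n + n') - e m n - e m n')
| TensorZl a m n : tensor_relation (e (a *: m) n - a *: e m n)
| TensorZr a m n : tensor_relation (e m (a *: n) - a *: e m n).

Definition tensor : lmodType R := quotmod (span_of tensor_relation).

Definition tens (m : M) (n : N) : tensor := quotmod_pi _ (e m n).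

End Def.

Variables (M M' N : lmodType R) (f : {linear M -> M'}).

Let ff : {linear freemod R (M * N)%type -> freemod R (M' * N)%type} :=
  freemod_lift (fun p => << (f p.1, p.2) >> : freemod R (M' * N)%type).

(* f (x) id_N *)
Definition tensor_map (t : tensor M N) : tensor M' N :=
  quotmod_pi _ (ff (quotmod_repr t)).

Let tensor_map_pi u :
  tensor_map (quotmod_pi _ u) = quotmod_pi (span_of _) (ff u).
Proof.
apply/quotmod_piP; rewrite -linearB; apply/asboolP => /= S hS.
have ffU m n : ff << (m, n) >> = << (f m, n) >>.
  by rewrite /ff /= freemod_liftU scale1r.
have : quotmod_repr (quotmod_pi (span_of (@tensor_relation M N)) u) - u
         \in span_of (@tensor_relation M N).
  by apply/quotmod_piP; rewrite quotmod_reprK.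
move: (_ - u) => v /asboolP vP.
pose S' : {pred freemod R (M * N)%type} := fun v => ff v \in S.
have S'E v' : (v' \in S') = (ff v' \in S) by [].
have S'P : submod_closed S'.
  split=> [|a x y]; rewrite !S'E; first by rewrite linear0 rpred0.
  by move=> xS yS; rewrite linearP rpredD ?rpredZ.
pose S'' : submodClosed (freemod R (M * N)%type) :=
  HB.pack S' (GRing.isSubmodClosed.Build R _ S' S'P).
apply: (vP S'') => _ [m m' n|m n n'|a m n|a m n];
  rewrite [_ \in S'']S'E.
- by rewrite !linearB !ffU linearD; apply: hS (TensorDl _ _ _).
- by rewrite !linearB !ffU; apply: hS (TensorDr _ _ _).
- by rewrite !linearB linearZ !ffU linearZ; apply: hS (TensorZl _ _ _).
- by rewrite !linearB linearZ !ffU; apply: hS (TensorZr _ _ _).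
Qed.

Lemma tensor_mapE m n : tensor_map (tens m n) = tens (f m) n.
Proof. by rewrite /tens tensor_map_pi /ff /= freemod_liftU scale1r. Qed.

Fact tensor_map_is_linear : linear tensor_map.
Proof.
move=> a u v; rewrite -[u]quotmod_reprK -[v]quotmod_reprK -linearP.
by rewrite !tensor_map_pi !linearP.
Qed.

HB.instance Definition _ := GRing.isLinear.Build R (tensor M N) (tensor M' N) _
  tensor_map tensor_map_is_linear.

End Tensor.

Arguments tensor_map {R M M'} N f t.

Section Homology.
Variables (R : comNzRingType) (U V W : lmodType R).
Variables (f : {linear U -> V}) (g : {linear V -> W}).

Definition boundary : {pred submod (kernel g)} := fun z =>
  `[< exists u : U, val z = f u >].

Fact boundary_submod_closed : submod_closed boundary.
Proof.
split=> [|a x y]; first by apply/asboolP; exists 0; rewrite !linear0.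
move=> /asboolP[u xE] /asboolP[v yE]; apply/asboolP; exists (a *: u + v).
by rewrite !linearP /= xE yE.
Qed.

HB.instance Definition _ := GRing.isSubmodClosed.Build R (submod (kernel g))
  boundary boundary_submod_closed.

(* ker g / im f; no condition g \o f = 0 is imposed here *)
Definition homology : lmodType R := quotmod boundary.

End Homology.

(* The functorial free resolution of M: the 0th syzygy is M, the i-th term is *)
(* the free module on the underlying set of the i-th syzygy, and the i+1-st *)
(* syzygy is the kernel of the canonical surjection from the i-th term. *)
Section FreeResolution.
Variables (R : comNzRingType) (M : lmodType R).

Definition free_cover (V : lmodType R) : freemod R V -> V :=
  freemod_lift (@id V).

HB.instance Definition _ (V : lmodType R) := GRing.Linear.on (@free_cover V).

Fixpoint syzygy (i : nat) : lmodType R :=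
  if i is j.+1 then submod (kernel (@free_cover (syzygy j))) else M.

Definition free_res (i : nat) : lmodType R := freemod R (syzygy i).

Definition free_res_diff (i : nat) : {linear free_res i.+1 -> free_res i} :=
  (val : syzygy i.+1 -> free_res i) \o @free_cover (syzygy i.+1).

Lemma free_cover_surj (V : lmodType R) (v : V) : exists x, free_cover x = v.
Proof. by exists << v >>; rewrite /free_cover freemod_liftU scale1r. Qed.

Lemma free_res_exact i (x : free_res i.+1) :
  free_res_diff i x = 0 <-> exists y, free_res_diff i.+1 y = x.
Proof.
have val0 : (val (0 : syzygy i.+1) : free_res i) = 0 by exact: linear0.
split=> [dx0|[y <-]].
  have zP : x \in kernel (@free_cover (syzygy i.+1)).
    by rewrite kernelE; apply/eqP/val_inj; rewrite val0.
  by have [y yE] := free_cover_surj (Submod zP); exists y; rewrite /= yE.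
have /eqP zE := valP (free_cover y : syzygy i.+2).
by rewrite -[RHS]val0 -zE.
Qed.

End FreeResolution.

(* The homology of free_res M (x) N; only degree 0 has no outgoing *)
(* differential, and 0 : P_0 (x) N -> N stands for it. *)
Definition Tor (R : comNzRingType) (i : nat) (M N : lmodType R) : lmodType R :=
  let d j : {linear _ -> _} := tensor_map N (free_res_diff M j) in
  if i is j.+1 then homology (d j.+1) (d j)
  else homology (d 0%N) (\0 : {linear tensor (free_res M 0) N -> N}).

Definition flat (R : comNzRingType) (F : lmodType R) : Prop :=
  forall (M N : lmodType R) (f : {linear M -> N}),
    injective f -> injective (tensor_map F f).

Record flat_resolution (R : comNzRingType) (M : lmodType R) :=
  FlatResolution {
    flat_term : nat -> lmodType R;
    flat_diff : forall i, {linear flat_term i.+1 -> flat_term i};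
    flat_aug : {linear flat_term 0 -> M};
    flat_termP : forall i, flat (flat_term i);
    flat_aug_surj : forall m, exists x, flat_aug x = m;
    flat_exact0 : forall x, flat_aug x = 0 <-> exists y, flat_diff 0 y = x;
    flat_exactS : forall i x,
      flat_diff i x = 0 <-> exists y, flat_diff i.+1 y = x }.

Definition flat_dim_le (R : comNzRingType) (M : lmodType R) (n : nat) : Prop :=
  exists F : flat_resolution M,
    forall i, (n < i)%N -> forall x : flat_term F i, x = 0.

Definition flat_dim_eq (R : comNzRingType) (M : lmodType R) (n : nat) : Prop :=
  flat_dim_le M n /\ forall m, flat_dim_le M m -> (n <= m)%N.

Definition lmod_isomorphic (R : comNzRingType) (M N : lmodType R) : Prop :=
  exists f : {linear M -> N}, bijective f.

(* V viewed as an R-module through f : R -> S; f is recorded in the alias so *)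
(* that the R-module structure can be inferred from it. *)
Definition restrict (R S : comNzRingType) (f : {rmorphism R -> S})
  (V : lmodType S) : Type := V.

Section Restriction.
Variables (R S : comNzRingType) (f : {rmorphism R -> S}) (V : lmodType S).

Local Notation restrict := (restrict f V).

HB.instance Definition _ := GRing.Zmodule.on restrict.

Definition restrict_scale (a : R) (v : restrict) : restrict := f a *: (v : V).

Fact restrict_scaleA a b v :
  restrict_scale a (restrict_scale b v) = restrict_scale (a * b) v.
Proof. by rewrite /restrict_scale rmorphM scalerA. Qed.

Fact restrict_scale1 : left_id 1 restrict_scale.
Proof. by move=> v; rewrite /restrict_scale rmorph1 scale1r. Qed.

Fact restrict_scaleDr : right_distributive restrict_scale +%R.
Proof. by move=> a u v; rewrite /restrict_scale scalerDr. Qed.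

Fact restrict_scaleDl v : {morph restrict_scale^~ v : a b / a + b}.
Proof. by move=> a b; rewrite /restrict_scale rmorphD scalerDl. Qed.

HB.instance Definition _ := GRing.Zmodule_isLmodule.Build R restrict
  restrict_scaleA restrict_scale1 restrict_scaleDr restrict_scaleDl.

End Restriction.

(* idealr is the type of proper ideals; on a commutative ring a proper ideal *)
(* containing every proper ideal is the unique maximal ideal. *)
Record localRing := LocalRing {
  local_sort :> comNzRingType;
  max_ideal : idealr local_sort;
  max_idealP : forall I : idealr local_sort, {subset I <= max_ideal} }.

Section ConstructionT.
Variable A : localRing.

Definition residue_field : comNzRingType := {ideal_quot (max_ideal A)}.

Definition residue : {rmorphism A -> residue_field} :=
  \pi_{ideal_quot (max_ideal A)}.

(* Sequences are indexed from 0. *)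
Definition T_pred : {pred A * (nat -> residue_field)} := fun x =>
  `[< finite_set [set i | x.2 i <> residue x.1]%classic >].

Fact T_subring_closed : subring_closed T_pred.
Proof.
split=> [|x y|x y].
- apply/asboolP; rewrite (_ : [set i | _]%classic = set0) //.
  by apply/seteqP; split=> i //=; rewrite rmorph1.
- move=> /asboolP xP /asboolP yP; apply/asboolP.
  apply: (@sub_finite_set _ _ (_ `|` _)%classic);
    last by rewrite finite_setU; split; [exact: xP|exact: yP].
  move=> i /= h; apply: contrapT => /not_orP[/contrapT xi /contrapT yi].
  apply: h; rewrite [RHS]rmorphB; exact: (congr2 (fun a b => a - b) xi yi).
- move=> /asboolP xP /asboolP yP; apply/asboolP.
  apply: (@sub_finite_set _ _ (_ `|` _)%classic);
    last by rewrite finite_setU; split; [exact: xP|exact: yP].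
  move=> i /= h; apply: contrapT => /not_orP[/contrapT xi /contrapT yi].
  apply: h; rewrite [RHS]rmorphM; exact: (congr2 *%R xi yi).
Qed.

HB.instance Definition _ := GRing.isSubringClosed.Build
  (A * (nat -> residue_field))%type T_pred T_subring_closed.

Record T : Type := MkT {
  T_val : A * (nat -> residue_field); _ : T_val \in T_pred }.

HB.instance Definition _ := [isSub for T_val].
HB.instance Definition _ := [Choice of T by <:].
HB.instance Definition _ := [SubChoice_isSubComNzRing of T by <:].

Definition T_fst : {rmorphism T -> A} := fst \o (val : T -> _).

End ConstructionT.

Section Localization.
Variables (D : idomainType) (P : prime_idealr D).

Local Notation "x %:F" := (@tofrac D x) (format "x %:F").

(* The localization of the domain D at P is realized in the field of fractions *)
(* of D. *)
Definition loc_pred : {pred {fraction D}} := fun x =>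
  `[< exists f g, g \notin P /\ x = f%:F / g%:F >].

Lemma notin_prime_neq0 g : g \notin P -> g%:F != 0.
Proof. by apply: contra; rewrite tofrac_eq0 => /eqP->; rewrite rpred0. Qed.

Lemma notin_primeM f g : f \notin P -> g \notin P -> f * g \notin P.
Proof. by move=> fP gP; rewrite prime_idealrM negb_or fP gP. Qed.

Lemma loc_frac_eq f g f' g' : g \notin P -> g' \notin P ->
  f%:F / g%:F = f'%:F / g'%:F -> f * g' = f' * g.
Proof.
move=> gP g'P /eqP; rewrite eqr_div ?notin_prime_neq0 // -!tofracM tofrac_eq.
by move/eqP.
Qed.

Lemma loc_fracB f g f' g' : g \notin P -> g' \notin P ->
  f%:F / g%:F - f'%:F / g'%:F = (f * g' - f' * g)%:F / (g * g')%:F.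
Proof.
move=> gP g'P; rewrite -mulNr addf_div ?notin_prime_neq0 //.
by rewrite mulNr tofracB !tofracM.
Qed.

Lemma loc_fracM f g f' g' :
  f%:F / g%:F * (f'%:F / g'%:F) = (f * f')%:F / (g * g')%:F.
Proof. by rewrite !tofracM mulf_div. Qed.

Fact loc_subring_closed : subring_closed loc_pred.
Proof.
split=> [|x y|x y].
- apply/asboolP; exists 1, 1; split; first by rewrite idealr1.
  by rewrite tofrac1 divr1.
- move=> /asboolP[f [g [gP ->]]] /asboolP[f' [g' [g'P ->]]]; apply/asboolP.
  exists (f * g' - f' * g), (g * g'); split; first exact: notin_primeM.
  exact: loc_fracB.
- move=> /asboolP[f [g [gP ->]]] /asboolP[f' [g' [g'P ->]]]; apply/asboolP.
  exists (f * f'), (g * g'); split; first exact: notin_primeM.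
  exact: loc_fracM.
Qed.

HB.instance Definition _ :=
  GRing.isSubringClosed.Build {fraction D} loc_pred loc_subring_closed.

Record loc : Type := Loc { loc_val : {fraction D}; _ : loc_val \in loc_pred }.

HB.instance Definition _ := [isSub for loc_val].
HB.instance Definition _ := [Choice of loc by <:].
HB.instance Definition _ := [SubChoice_isSubComNzRing of loc by <:].

(* The extension of P to the localization. *)
Definition loc_max : {pred loc} := fun x =>
  `[< exists f g, [/\ f \in P, g \notin P & val x = f%:F / g%:F] >].

Lemma loc_maxP (x : loc) f g :
  g \notin P -> val x = f%:F / g%:F -> (x \in loc_max) = (f \in P).
Proof.
move=> gP xE; apply/asboolP/idP=> [[f' [g' [f'P g'P]]]|fP]; last by exists f, g.
rewrite xE => /(loc_frac_eq gP g'P) fg.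
have : f * g' \in P by rewrite fg mulrC idealMr.
by rewrite prime_idealrM (negPf g'P) orbF.
Qed.

Fact loc_max_idealr_closed : idealr_closed loc_max.
Proof.
split=> [||a].
- by rewrite (loc_maxP (f := 0) (g := 1)) ?rpred0 ?idealr1 // tofrac0 mul0r.
- by rewrite (loc_maxP (f := 1) (g := 1)) ?idealr1 // tofrac1 divr1.
move=> u v /asboolP[f [g [fP gP uE]]] /asboolP[f' [g' [f'P g'P vE]]].
have /asboolP[b [c [cP aE]]] := valP a.
rewrite (loc_maxP (f := b * f * g' + f' * (c * g)) (g := c * g * g')).
- by rewrite rpredD // mulrC !idealMr // mulrC idealMr.
- by rewrite !notin_primeM.
rewrite rmorphD rmorphM /= uE vE aE mulf_div addf_div ?mulf_neq0 ?notin_prime_neq0 //.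
by rewrite !(tofracD, tofracM).
Qed.

HB.instance Definition _ := isIdealr.Build loc loc_max loc_max_idealr_closed.

Fact loc_max_maximal (I : idealr loc) : {subset I <= loc_max}.
Proof.
move=> x xI; have /asboolP[f [g [gP xE]]] := valP x.
rewrite (loc_maxP gP xE); apply: contraT => fP.
have yP : g%:F / f%:F \in loc_pred by apply/asboolP; exists g, f.
suff : Loc yP * x \in I.
  suff -> : Loc yP * x = 1 by rewrite idealr1.
  apply: val_inj; rewrite /= xE mulf_div [X in _ / X]mulrC divff //.
  by rewrite mulf_neq0 ?notin_prime_neq0.
exact: idealMr.
Qed.

Definition localization : localRing := LocalRing loc_max_maximal.

End Localization.

Section PolynomialLocalRing.
Variables (k : fieldType) (n : nat).

Local Notation "x %:F" := (@tofrac {mpoly k[n]} x) (format "x %:F").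

(* The ideal (x_1, ..., x_n) of k[x_1, ..., x_n]. *)
Definition origin_ideal : {pred {mpoly k[n]}} := fun f =>
  `[< exists c : 'I_n -> {mpoly k[n]}, f = \sum_i c i * 'X_i >].

Lemma origin_idealE f : (f \in origin_ideal) = (f@_0%MM == 0).
Proof.
apply/asboolP/eqP=> [[c ->]|].
  rewrite raddf_sum big1 // => i _; rewrite /= rmorphM /= mcoeffX.
  by rewrite (_ : (U_(i) == 0)%MM = false) ?mulr0 // mnm1_eq0.
move=> f0; rewrite [f]mpolyE big_seq.
pose I (g : {mpoly k[n]}) :=
  exists c : 'I_n -> {mpoly k[n]}, g = \sum_i c i * 'X_i.
apply: (@big_ind _ I) => [|g h [c ->] [d ->]|m mf].
- by exists (fun=> 0); rewrite big1 // => i _; rewrite mul0r.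
- exists (fun i => c i + d i); rewrite -big_split.
  by apply: eq_bigr => i _; rewrite mulrDl.
have m0 : m != 0%MM.
  by apply: contraTneq mf => ->; rewrite mcoeff_msupp f0 eqxx.
have [i mi] : exists i, m i != 0%N.
  apply/existsP; rewrite -negb_forall; apply: contra m0 => /forallP m0.
  by apply/eqP/mnmP => i; rewrite mnm0E; apply/eqP/m0.
exists (fun j => if j == i then f@_m *: 'X_[m - U_(i)] else 0).
rewrite (bigD1 i) //= eqxx big1 ?addr0; last first.
  by move=> j /negPf->; rewrite mul0r.
rewrite -scalerAl -mpolyXD submK //.
by apply/mnm_lepP => j; rewrite mnm1E; case: eqP => // <-; rewrite lt0n.
Qed.

Fact origin_idealr_closed : idealr_closed origin_ideal.
Proof.
split=> [||a u v]; rewrite !origin_idealE ?mcoeff0 ?mcoeff1 ?eqxx ?oner_eq0 //.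
by move=> /eqP u0 /eqP v0; rewrite mcoeffD rmorphM /= u0 v0 mulr0 addr0.
Qed.

HB.instance Definition _ :=
  isIdealr.Build {mpoly k[n]} origin_ideal origin_idealr_closed.

Fact origin_prime_idealr_closed : prime_idealr_closed origin_ideal.
Proof.
by move=> u v; rewrite !origin_idealE rmorphM mulf_eq0.
Qed.

HB.instance Definition _ := isPrimeIdealrClosed.Build {mpoly k[n]} origin_ideal
  origin_prime_idealr_closed.

Definition A_ : localRing := localization origin_ideal.

(* The reduction A_n -> k, sending f / g to f(0) / g(0). *)
Fact A_fracP (x : A_) : exists fg : {mpoly k[n]} * {mpoly k[n]},
  fg.2 \notin origin_ideal /\ loc_val x = fg.1%:F / fg.2%:F.
Proof. by have /asboolP[f [g h]] := valP x; exists (f, g). Qed.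

Definition A_reduce (x : A_) : k :=
  let fg := projT1 (cid (A_fracP x)) in fg.1@_0%MM / fg.2@_0%MM.

Lemma A_reduceE (x : A_) (f g : {mpoly k[n]}) :
  g \notin origin_ideal -> loc_val x = f%:F / g%:F ->
  A_reduce x = f@_0%MM / g@_0%MM.
Proof.
move=> gP xE; rewrite /A_reduce; case: cid => -[f' g'] /= [g'P x'E].
move: xE; rewrite x'E => /(loc_frac_eq g'P gP)/(congr1 (mcoeff 0%MM)).
rewrite !rmorphM /= => fg; apply/eqP.
by rewrite eqr_div -?origin_idealE ?fg.
Qed.

Fact A_reduce_is_zmod_morphism : zmod_morphism A_reduce.
Proof.
move=> x y; have [[f g] /= [gP xE]] := A_fracP x.
have [[f' g'] /= [g'P yE]] := A_fracP y.
rewrite (A_reduceE gP xE) (A_reduceE g'P yE).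
have g0 : g@_0%MM != 0 by rewrite -origin_idealE.
have g'0 : g'@_0%MM != 0 by rewrite -origin_idealE.
have xyE : loc_val (x - y) = (f * g' - f' * g)%:F / (g * g')%:F.
  by rewrite -(loc_fracB f f' gP g'P) -xE -yE.
rewrite (A_reduceE (notin_primeM gP g'P) xyE).
by rewrite rmorphB !rmorphM /= -[X in _ = _ + X]mulNr addf_div // mulNr.
Qed.

Fact A_reduce_is_monoid_morphism : monoid_morphism A_reduce.
Proof.
split.
  rewrite (@A_reduceE 1 1 1) ?idealr1 //; last by rewrite tofrac1 divr1.
  by rewrite mcoeff1 eqxx divr1.
move=> x y; have [[f g] /= [gP xE]] := A_fracP x.
have [[f' g'] /= [g'P yE]] := A_fracP y.
rewrite (A_reduceE gP xE) (A_reduceE g'P yE).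
have xyE : loc_val (x * y) = (f * f')%:F / (g * g')%:F.
  by rewrite -loc_fracM -xE -yE.
by rewrite (A_reduceE (notin_primeM gP g'P) xyE) !rmorphM /= mulf_div.
Qed.

HB.instance Definition _ :=
  GRing.isZmodMorphism.Build A_ k A_reduce A_reduce_is_zmod_morphism.
HB.instance Definition _ :=
  GRing.isMonoidMorphism.Build A_ k A_reduce A_reduce_is_monoid_morphism.

Lemma A_reduce_eq0 (x : A_) : (A_reduce x == 0) = (x \in max_ideal A_).
Proof.
have [[f g] /= [gP xE]] := A_fracP x.
rewrite (A_reduceE gP xE) [RHS](loc_maxP gP xE) origin_idealE mulf_eq0 invr_eq0.
by rewrite -(origin_idealE g) (negPf gP) orbF.
Qed.

Lemma A_reduce_surj (c : k) : exists x, A_reduce x = c.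
Proof.
have cP : c%:MP%:F \in loc_pred origin_ideal.
  by apply/asboolP; exists c%:MP, 1; rewrite idealr1 tofrac1 divr1.
exists (Loc cP); rewrite (@A_reduceE _ c%:MP 1) ?idealr1 //.
  by rewrite mcoeffC mcoeff1 eqxx mulr1 divr1.
by rewrite tofrac1 divr1.
Qed.

Definition R_ : comNzRingType := T A_.

Definition R_reduce : {rmorphism R_ -> k} := A_reduce \o @T_fst A_.

Definition R_kvec (m : nat) : lmodType R_ := restrict R_reduce 'rV[k]_m.

Definition R_k : lmodType R_ := restrict R_reduce k^o.

End PolynomialLocalRing.

(* Main.v *)
(* The kernel of R_n -> A_n consists of sequences with finite support, so each of
   its elements is annihilated by some r that maps to 1 in A_n: A_n is a
   localization of R_n, hence flat. The Koszul complex of A_n on x_1, ..., x_n is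
   therefore a flat resolution of k over R_n, of length n. Its differentials
   vanish modulo the maximal ideal, so they vanish after tensoring with k, and
   Tor_i(k, k) has rank binomial(n, i). Since Tor is defined by a free resolution
   of its first argument, it is compared with flat resolutions F of the second one
   by dimension shifting: Tor_(i+1)(M, N) is the kernel of
   M (x) Z -> M (x) F_i, where Z is the image of F_(i+1) -> F_i. For a flat
   resolution of k of length m < n this gives Tor_n(k, k) = 0, a contradiction. *)
From HB Require Import structures.
From mathcomp Require Import all_boot all_algebra.
From mathcomp Require Import boolp classical_sets functions cardinality.
From mathcomp Require Import freeg mpoly.
Require Import Defs.

Set Implicit Arguments.
Unset Strict Implicit.
Unset Printing Implicit Defensive.

Import GRing.Theory.

Local Open Scope ring_scope.

(** * Tensor products *)

Lemma exists_linear (R : comNzRingType) (U V : lmodType R) (f : U -> V) :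
  linear f -> exists h : {linear U -> V}, forall u, h u = f u.
Proof.
move=> fP.
pose h : {linear U -> V} := HB.pack f (GRing.isLinear.Build R U V _ f fP).
by exists h.
Qed.

Lemma quotmod_lift (R : comNzRingType) (V W : lmodType R) (S : submodClosed V)
    (h : {linear V -> W}) : (forall v, v \in S -> h v = 0) ->
  exists g : {linear quotmod S -> W}, forall v, g (quotmod_pi S v) = h v.
Proof.
move=> hS.
have gE v : h (quotmod_repr (quotmod_pi S v)) = h v.
  apply/eqP; rewrite -subr_eq0 -linearB; apply/eqP/hS.
  by apply/quotmod_piP; rewrite quotmod_reprK.
have gP : linear (fun q : quotmod S => h (quotmod_repr q)).
  move=> a u v; rewrite -[u]quotmod_reprK -[v]quotmod_reprK -linearP !gE.
  exact: linearP.
by have [g gE'] := exists_linear gP; exists g => v; rewrite gE' gE.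
Qed.

Section TensorBasics.
Variables (R : comNzRingType) (M N : lmodType R).

Let pi := @quotmod_pi R _ (span_of (@tensor_relation R M N)).

Let pi_rel x : tensor_relation x -> pi x = 0.
Proof.
move=> h; rewrite -(linear0 pi); apply/quotmod_piP.
by rewrite subr0; apply: sub_span_of.
Qed.

Lemma tensDl (m m' : M) (n : N) : tens (m + m') n = tens m n + tens m' n.
Proof.
apply/eqP; rewrite -subr_eq0 opprD addrA; apply/eqP.
by rewrite /tens -!linearB; apply: pi_rel (TensorDl _ _ _).
Qed.

Lemma tensDr (m : M) (n n' : N) : tens m (n + n') = tens m n + tens m n'.
Proof.
apply/eqP; rewrite -subr_eq0 opprD addrA; apply/eqP.
by rewrite /tens -!linearB; apply: pi_rel (TensorDr _ _ _).
Qed.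

Lemma tensZl a (m : M) (n : N) : tens (a *: m) n = a *: tens m n.
Proof.
apply/eqP; rewrite -subr_eq0; apply/eqP.
by rewrite /tens -linearZ -linearB; apply: pi_rel (TensorZl _ _ _).
Qed.

Lemma tensZr a (m : M) (n : N) : tens m (a *: n) = a *: tens m n.
Proof.
apply/eqP; rewrite -subr_eq0; apply/eqP.
by rewrite /tens -linearZ -linearB; apply: pi_rel (TensorZr _ _ _).
Qed.

Lemma tens0l (n : N) : tens (0 : M) n = 0.
Proof. by rewrite -(scale0r (0 : M)) tensZl scale0r. Qed.

Lemma tens0r (m : M) : tens m (0 : N) = 0.
Proof. by rewrite -(scale0r (0 : N)) tensZr scale0r. Qed.

Lemma tens_sumr (m : M) (I : Type) (s : seq I) (F : I -> N) :
  tens m (\sum_(i <- s) F i) = \sum_(i <- s) tens m (F i).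
Proof. by apply: (big_morph (tens m)); [exact: tensDr|exact: tens0r]. Qed.

(** A scalar multiple of a pure tensor is again pure, by moving the scalar into the left factor, and
    0 is pure; so every tensor is a sum of pure ones. *)
Lemma tensor_ind (P : tensor M N -> Prop) :
  (forall m n, P (tens m n)) -> (forall x y, P x -> P y -> P (x + y)) ->
  forall t, P t.
Proof.
move=> Pt PD t; rewrite -[t]quotmod_reprK -[quotmod_repr t]freeg_sumE.
rewrite linear_sum; apply: big_ind => [||[m n] _] //.
  by rewrite -(tens0l 0).
have -> : << coeff (m, n) (quotmod_repr t) *g (m, n) >>
          = coeff (m, n) (quotmod_repr t) *: (<< (m, n) >> : freemod R (M * N)%type).
  by apply/eqP/freeg_eqP => y; rewrite coeffZ !coeffU mul1r.
rewrite linearZ; have := Pt (coeff (m, n) (quotmod_repr t) *: m) n.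
by rewrite tensZl.
Qed.

Lemma tensor_lift (W : lmodType R) (b : M -> N -> W) :
  (forall n, linear (b^~ n)) -> (forall m, linear (b m)) ->
  exists h : {linear tensor M N -> W}, forall m n, h (tens m n) = b m n.
Proof.
move=> bl br.
pose b' : {linear freemod R (M * N)%type -> W} :=
  freemod_lift (fun p : M * N => b p.1 p.2).
have b'U m n : b' << (m, n) >> = b m n.
  by rewrite /b' /= freemod_liftU scale1r.
have [|h hE] := @quotmod_lift R _ W (span_of (@tensor_relation R M N)) b'.
  move=> v /asboolP vP.
  (* [span_of] is an intersection of submodules, so it suffices that the kernel of [b'] contains the
     four families of relations. *)
  apply/eqP; apply: (vP (kernel b')) => _ [m m' n|m n n'|a m n|a m n];
    rewrite kernelE !linearB subr_eq0 1?subr_eq;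
    have [f fE] := exists_linear (bl n); have [g gE] := exists_linear (br m).
  - by rewrite !b'U -!fE linearD addrC.
  - by rewrite !b'U -!gE linearD addrC.
  - by rewrite linearZ_LR !b'U -!fE linearZ_LR.
  - by rewrite linearZ_LR !b'U -!gE linearZ_LR.
by exists h => m n; rewrite hE b'U.
Qed.

End TensorBasics.

Section LinImage.
Variables (R : comNzRingType) (U V : lmodType R) (f : {linear U -> V}).

Definition lin_image : {pred V} := fun v => `[< exists u, v = f u >].

Lemma lin_imageP v : reflect (exists u, v = f u) (v \in lin_image).
Proof. exact: asboolP. Qed.

Fact lin_image_submod_closed : submod_closed lin_image.
Proof.
split=> [|a _ _ /lin_imageP[u ->] /lin_imageP[v ->]]; apply/lin_imageP.
  by exists 0; rewrite linear0.
by exists (a *: u + v); rewrite linearP.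
Qed.

HB.instance Definition _ := GRing.isSubmodClosed.Build R V lin_image
  lin_image_submod_closed.

End LinImage.

(** * Functoriality and right exactness of the tensor product *)

Section TensorMaps.
Variables (R : comNzRingType).
Implicit Types (M N U V W : lmodType R).

Lemma tensor_ext M N W (h h' : {linear tensor M N -> W}) :
  (forall m n, h (tens m n) = h' (tens m n)) -> h =1 h'.
Proof.
by move=> E; apply: tensor_ind => // x y; rewrite !linearD => -> ->.
Qed.

Fact tensor_mapr_ex M N N' (g : {linear N -> N'}) :
  exists h : {linear tensor M N -> tensor M N'},
    forall m n, h (tens m n) = tens m (g n).
Proof.
by apply: tensor_lift => [n a m m'|m a n n'];
  rewrite ?linearP ?tensDl ?tensDr ?tensZl ?tensZr.
Qed.

Definition tensor_mapr M N N' (g : {linear N -> N'}) :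
  {linear tensor M N -> tensor M N'} := projT1 (cid (tensor_mapr_ex M g)).

Lemma tensor_maprE M N N' (g : {linear N -> N'}) m n :
  tensor_mapr M g (tens m n) = tens m (g n).
Proof. by rewrite /tensor_mapr; case: cid. Qed.

Lemma tensor_map_mapr M M' N N' (f : {linear M -> M'}) (g : {linear N -> N'})
    t :
  tensor_map N' f (tensor_mapr M g t) = tensor_mapr M' g (tensor_map N f t).
Proof.
apply: (@tensor_ext _ _ _ (tensor_map N' f \o tensor_mapr M g)
  (tensor_mapr M' g \o tensor_map N f)) => m n /=.
by rewrite tensor_maprE !tensor_mapE tensor_maprE.
Qed.

Lemma tensor_map_comp M M' M'' N (f : {linear M' -> M''})
    (g : {linear M -> M'}) (h : {linear M -> M''}) t : h =1 f \o g ->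
  tensor_map N h t = tensor_map N f (tensor_map N g t).
Proof.
move=> E; apply: (@tensor_ext _ _ _ (tensor_map N h)
  (tensor_map N f \o tensor_map N g)) => m n /=.
by rewrite !tensor_mapE E.
Qed.

Lemma tensor_mapr_comp M N N' N'' (f : {linear N' -> N''})
    (g : {linear N -> N'}) (h : {linear N -> N''}) t : h =1 f \o g ->
  tensor_mapr M h t = tensor_mapr M f (tensor_mapr M g t).
Proof.
move=> E; apply: (@tensor_ext _ _ _ (tensor_mapr M h)
  (tensor_mapr M f \o tensor_mapr M g)) => m n /=.
by rewrite !tensor_maprE E.
Qed.

Lemma tensor_map0 M M' N (f : {linear M -> M'}) t : (forall m, f m = 0) ->
  tensor_map N f t = 0.
Proof.
move=> f0; apply: (@tensor_ext _ _ _ (tensor_map N f) \0) => m n /=.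
by rewrite tensor_mapE f0 tens0l.
Qed.

Lemma tensor_mapr0 M N N' (g : {linear N -> N'}) t : (forall n, g n = 0) ->
  tensor_mapr M g t = 0.
Proof.
move=> g0; apply: (@tensor_ext _ _ _ (tensor_mapr M g) \0) => m n /=.
by rewrite tensor_maprE g0 tens0r.
Qed.

Lemma tensor_map_surj M M' N (f : {linear M -> M'}) :
  (forall m', exists m, f m = m') -> forall t, exists u, tensor_map N f u = t.
Proof.
move=> fS; elim/tensor_ind=> [m n|x y [u <-] [v <-]].
  by have [m' <-] := fS m; exists (tens m' n); rewrite tensor_mapE.
by exists (u + v); exact: linearD.
Qed.

Lemma tensor_mapr_surj M N N' (g : {linear N -> N'}) :
  (forall n', exists n, g n = n') -> forall t, exists u, tensor_mapr M g u = t.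
Proof.
move=> gS; elim/tensor_ind=> [m n|x y [u <-] [v <-]].
  by have [n' <-] := gS n; exists (tens m n'); rewrite tensor_maprE.
by exists (u + v); exact: linearD.
Qed.

(** Right exactness: the projection of [V (x) N] to the cokernel of [i (x) N] factors through
    [p (x) N], so a tensor killed by [p (x) N] is zero in that cokernel. *)
Lemma tensor_map_exact U V V' N (i : {linear U -> V}) (p : {linear V -> V'}) t :
  (forall v', exists v, p v = v') ->
  (forall v, p v = 0 -> exists u, i u = v) ->
  tensor_map N p t = 0 -> exists u, tensor_map N i u = t.
Proof.
move=> /choice[s sK] pi0 pt0.
pose S : submodClosed (tensor V N) := @lin_image R _ _ (tensor_map N i).
have piE v v' n : p v = p v' ->
    quotmod_pi S (tens v n) = quotmod_pi S (tens v' n).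
  move=> /eqP; rewrite -subr_eq0 -linearB => /eqP/pi0[u uE].
  apply/quotmod_piP/lin_imageP; exists (tens u n).
  by rewrite /= tensor_mapE -[v](subrK v') -uE tensDl addrK.
(* The set-theoretic section [s] of [p] need not be linear, but by [piE] it becomes so modulo the
   image of [i (x) N]. *)
have [n a v v'|v a n n'|h hE] :=
    @tensor_lift R V' N (quotmod S) (fun v' n => quotmod_pi S (tens (s v') n)).
- rewrite -linearP -tensZl -tensDl; apply: piE.
  by rewrite linearP !sK.
- by rewrite tensDr tensZr linearP.
have : h (tensor_map N p t) = quotmod_pi S t.
  apply: (@tensor_ext _ _ _ (h \o tensor_map N p) (quotmod_pi S)) => v n /=.
  by rewrite tensor_mapE hE; apply: piE; rewrite sK.
rewrite pt0 linear0 -(linear0 (quotmod_pi S)) => /esym/quotmod_piP.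
by rewrite subr0 => /lin_imageP[u ->]; exists u.
Qed.

End TensorMaps.

(** * Coordinates in the tensor product with a free module *)

Section FreeTensor.
Variables (R : comNzRingType) (X : choiceType).
Implicit Types (N : lmodType R).

Local Notation P := (freemod R X).

Fact tensor_coef_ex N (x : X) : exists h : {linear tensor P N -> N},
  forall (p : P) n, h (tens p n) = coeff x p *: n.
Proof.
pose c : {linear P -> R^o} := freemod_lift (fun y => (y == x)%:R : R^o).
apply: (@tensor_lift R P N N (fun p n => c p *: n)) => [n a p q|p a n n'].
  by rewrite linearP scalerDl scalerA.
by rewrite scalerDr !scalerA mulrC.
Qed.

Definition tensor_coef N (x : X) : {linear tensor P N -> N} :=
  projT1 (cid (tensor_coef_ex N x)).

Lemma tensor_coefE N x (p : P) n :
  tensor_coef N x (tens p n) = coeff x p *: n.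
Proof. by rewrite /tensor_coef; case: cid. Qed.

Lemma tensor_coef_mapr N N' (g : {linear N -> N'}) x t :
  tensor_coef N' x (tensor_mapr P g t) = g (tensor_coef N x t).
Proof.
have E : tensor_coef N' x \o tensor_mapr P g =1 g \o tensor_coef N x.
  apply: tensor_ext => m n /=.
  by rewrite tensor_maprE !tensor_coefE linearZ.
exact: E t.
Qed.

Lemma freemod_sum_coef (p : P) (s : seq X) :
  {subset dom p <= s} -> uniq s -> \sum_(x <- s) coeff x p *: (<< x >> : P) = p.
Proof.
move=> ps us; apply/eqP/freeg_eqP => y; rewrite raddf_sum /=.
have E x : coeff y (coeff x p *: (<< x >> : P)) = coeff x p * (x == y)%:R.
  by rewrite coeffZ coeffU mul1r.
rewrite (eq_bigr _ (fun x _ => E x)).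
have [ys|ys] := boolP (y \in s); last first.
  rewrite big_seq big1 => [|x xs].
    by rewrite coeff_outdom //; apply: contra ys; apply: ps.
  by rewrite (_ : x == y = false) ?mulr0 //; apply: contraNF ys => /eqP <-.
rewrite (bigD1_seq y) //= eqxx mulr1 big1 ?addr0 // => x /negPf ->.
by rewrite mulr0.
Qed.

Lemma tensor_coef_sum N (t : tensor P N) :
  exists s : seq X, t = \sum_(x <- s) tens (<< x >> : P) (tensor_coef N x t).
Proof.
(* The claim is strengthened to all larger duplicate-free lists, so that in the additive step one
   list serves both summands. *)
suff [s sP] : exists s : seq X, forall s' : seq X, {subset s <= s'} -> uniq s' ->
    t = \sum_(x <- s') tens (<< x >> : P) (tensor_coef N x t).
  by exists (undup s); apply: sP => [x|]; rewrite ?mem_undup ?undup_uniq.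
elim/tensor_ind: t => [p n|u v [su suP] [sv svP]].
  exists (dom p) => s ps us; rewrite -[p in LHS](freemod_sum_coef ps us).
  rewrite (big_morph (fun q => tens q n) (fun q q' => tensDl q q' n) (tens0l _ n)).
  by apply: eq_bigr => x _; rewrite tensor_coefE tensZl tensZr.
exists (su ++ sv) => s sS us.
rewrite {1}(suP s) //; last by move=> x xs; apply: sS; rewrite mem_cat xs.
rewrite {1}(svP s) //; last by move=> x xs; apply: sS; rewrite mem_cat xs orbT.
by rewrite -big_split; apply: eq_bigr => x _; rewrite linearD tensDr.
Qed.

Lemma freemod_mapr_inj N N' (g : {linear N -> N'}) t : injective g ->
  tensor_mapr P g t = 0 -> t = 0.
Proof.
move=> gI gt0; have [s ->] := tensor_coef_sum t; apply: big1 => x _.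
suff -> : tensor_coef N x t = 0 by rewrite tens0r.
by apply: gI; rewrite -tensor_coef_mapr gt0 !linear0.
Qed.

(** [P (x) N'] is a direct sum of copies of [N'], so preimages are found one coordinate at a
    time. *)
Lemma freemod_mapr_exact N N' N'' (i : {linear N -> N'}) (g : {linear N' -> N''})
    t : (forall n, g n = 0 -> exists u, i u = n) ->
  tensor_mapr P g t = 0 -> exists u, tensor_mapr P i u = t.
Proof.
move=> gi gt0; have [s ->] := tensor_coef_sum t.
have /choice[f fE] (x : X) : exists u, i u = tensor_coef N' x t.
  by apply: gi; rewrite -tensor_coef_mapr gt0 linear0.
exists (\sum_(x <- s) tens (<< x >> : P) (f x)).
by rewrite linear_sum; apply: eq_bigr => x _; rewrite tensor_maprE fE.
Qed.

End FreeTensor.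

(** * Homology and dimension shifting *)

Lemma lmod_isomorphic_trans (R : comNzRingType) (U V W : lmodType R) :
  lmod_isomorphic U V -> lmod_isomorphic V W -> lmod_isomorphic U W.
Proof. by move=> [f fB] [g gB]; exists (g \o f); apply: bij_comp. Qed.

Lemma lmod_isomorphic_of (R : comNzRingType) (U V : lmodType R)
    (f : {linear U -> V}) :
  (forall u, f u = 0 -> u = 0) -> (forall v, exists u, f u = v) ->
  lmod_isomorphic U V.
Proof.
move=> f0 /choice[g gK]; exists f; exists g => // u.
by apply/eqP; rewrite -subr_eq0; apply/eqP/f0; rewrite linearB gK subrr.
Qed.

Section HomologyRelation.
Variables (R : comNzRingType) (U V V' W : lmodType R).
Variables (f : {linear U -> V}) (g : {linear V -> V'}) (rel : V -> W -> Prop).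

Hypothesis rel_linear : forall a z w z' w',
  rel z w -> rel z' w' -> rel (a *: z + z') (a *: w + w').
Hypothesis rel_total : forall z, g z = 0 -> exists w, rel z w.
Hypothesis rel_onto : forall w, exists2 z, g z = 0 & rel z w.
Hypothesis rel_boundary : forall z w, g z = 0 -> rel z w ->
  (exists u, f u = z) <-> w = 0.

(** Diagram chases produce relations rather than functions. Applied to the cycle 0, [rel_boundary]
    makes the relation single-valued; it is then the graph of a surjective linear map on cycles
    whose kernel consists of the boundaries. *)
Lemma homology_rel_iso : lmod_isomorphic (homology f g) W.
Proof.
have valK (z : submod (kernel g)) : g (val z) = 0 by apply/eqP/(valP z).
have [s sP] := choice (fun z : submod (kernel g) => rel_total (valK z)).
have sE (z : submod (kernel g)) w : rel (val z) w -> s z = w.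
  move=> zw; apply/eqP; rewrite -subr_eq0 addrC; apply/eqP.
  have := rel_linear (-1) zw (sP z); rewrite !scaleN1r addNr.
  by move/(rel_boundary (linear0 g)) => <-; exists 0; rewrite linear0.
have s_lin : linear s.
  by move=> a x y; apply: sE; rewrite linearP; exact: rel_linear (sP x) (sP y).
have [s' s'E] := exists_linear s_lin.
have [z|h hE] := @quotmod_lift R _ W (@boundary _ _ _ _ f g) s'.
  move=> /asboolP[u zE]; rewrite s'E.
  by apply/(rel_boundary (valK z) (sP z)); exists u.
apply: (@lmod_isomorphic_of _ _ _ h) => [q|w].
  rewrite -[q]quotmod_reprK hE s'E => /(rel_boundary (valK _) (sP _))[u uE].
  rewrite -(linear0 (quotmod_pi (@boundary _ _ _ _ f g))); apply/quotmod_piP.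
  by rewrite subr0; apply/asboolP; exists u.
have [z gz zw] := rel_onto w.
have zP : z \in kernel g by rewrite kernelE gz.
by exists (quotmod_pi _ (Submod zP)); rewrite hE s'E; apply: sE.
Qed.

End HomologyRelation.

(* Connecting morphism of 0 -> A -> B -> C -> 0 for B acyclic in positive
   degrees; A' and B' are the 0th homology modules of A and B. *)
Section Connecting.
Variables (R : comNzRingType) (A B C : nat -> lmodType R).
Variables (a : forall i, {linear A i.+1 -> A i}).
Variables (b : forall i, {linear B i.+1 -> B i}).
Variables (c : forall i, {linear C i.+1 -> C i}).
Variables (l : forall i, {linear A i -> B i}) (p : forall i, {linear B i -> C i}).

Hypothesis lC : forall i x, l i (a i x) = b i (l i.+1 x).
Hypothesis pC : forall i x, p i (b i x) = c i (p i.+1 x).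
Hypothesis l_inj : forall i x, l i x = 0 -> x = 0.
Hypothesis p_surj : forall i y, exists x, p i x = y.
Hypothesis pl0 : forall i x, p i (l i x) = 0.
Hypothesis pl_exact : forall i x, p i x = 0 -> exists y, l i y = x.
Hypothesis bb0 : forall i x, b i (b i.+1 x) = 0.
Hypothesis b_exact : forall i x, b i x = 0 -> exists y, b i.+1 y = x.

Lemma connecting_iso j : lmod_isomorphic
  (homology (c j.+2) (c j.+1)) (homology (a j.+1) (a j)).
Proof.
pose pi := @quotmod_pi R _ (@boundary _ _ _ _ (a j.+1) (a j)).
(* The zigzag of the snake lemma: [y] lifts the cycle [z] to B, and its differential comes from the
   cycle [w] of A. *)
apply: (@homology_rel_iso _ _ _ _ _ _ _ (fun z q =>
  exists y (w : submod (kernel (a j))),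
  [/\ p _ y = z, b j.+1 y = l _ (val w) & q = pi w])).
- move=> e z q z' q' [y [w [<- yw ->]]] [y' [w' [<- yw' ->]]].
  exists (e *: y + y'), (e *: w + w').
  by split; rewrite ?/pi !linearP ?yw ?yw'.
- move=> z cz; have [y yz] := p_surj z.
  have [|w wE] := @pl_exact j.+1 (b j.+1 y); first by rewrite pC yz.
  have wP : w \in kernel (a j).
    by rewrite kernelE; apply/eqP/l_inj; rewrite lC wE bb0.
  by exists (pi (Submod wP)), y, (Submod wP).
- move=> q; have [w <-] : exists w, pi w = q.
    by exists (quotmod_repr q); rewrite /pi quotmod_reprK.
  have /eqP aw0 := valP w.
  have [|y yE] := @b_exact j (l _ (val w)); first by rewrite -lC aw0 linear0.
  exists (p _ y); first by rewrite -pC yE pl0.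
  by exists y, w.
move=> _ _ _ [y [w [<- yw ->]]]; rewrite -(linear0 pi); split.
  (* If [z] bounds [z'], correcting [y] by the differential of a lift of [z'] leaves an element [w']
     of A whose boundary is [w]. *)
  move=> [z' z'E]; have [y' y'E] := p_surj z'.
  have [|w' w'E] := @pl_exact j.+2 (y - b j.+2 y').
    by rewrite linearB pC y'E z'E subrr.
  apply/quotmod_piP; rewrite subr0; apply/asboolP; exists w'.
  apply/eqP; rewrite -subr_eq0; apply/eqP/l_inj.
  by rewrite linearB lC w'E linearB bb0 subr0 yw subrr.
move=> /quotmod_piP; rewrite subr0 => /asboolP[w' w'E].
have [|y' y'E] := @b_exact j.+1 (y - l _ w').
  by rewrite linearB -lC -w'E yw subrr.
by exists (p _ y'); rewrite -pC y'E linearB pl0 subr0.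
Qed.

Variables (A' B' : lmodType R) (l' : {linear A' -> B'}).
Variables (eA : {linear A 0 -> A'}) (eB : {linear B 0 -> B'}).
Hypothesis eA_surj : forall y, exists x, eA x = y.
Hypothesis eAa0 : forall x, eA (a 0 x) = 0.
Hypothesis eA_exact : forall x, eA x = 0 -> exists y, a 0 y = x.
Hypothesis eBb0 : forall x, eB (b 0 x) = 0.
Hypothesis eB_exact : forall x, eB x = 0 -> exists y, b 0 y = x.
Hypothesis lE : forall x, l' (eA x) = eB (l 0 x).

(** The end of the long exact sequence: since B has no homology in degree 1, the first homology of C
    is the kernel of the map induced on degree 0. *)
Lemma connecting_iso0 :
  lmod_isomorphic (homology (c 1) (c 0)) (submod (kernel l')).
Proof.
apply: (@homology_rel_iso _ _ _ _ _ _ _ (fun z (q : submod (kernel l')) =>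
  exists y w, [/\ p _ y = z, b 0 y = l _ w & eA w = val q])).
- move=> e z q z' q' [y [w [<- yw wq]]] [y' [w' [<- yw' wq']]].
  exists (e *: y + y'), (e *: w + w').
  by split; rewrite !linearP ?yw ?yw' ?wq ?wq'.
- move=> z cz; have [y yz] := p_surj z.
  have [|w wE] := @pl_exact 0 (b 0 y); first by rewrite pC yz.
  have wP : eA w \in kernel l' by rewrite kernelE lE wE eBb0.
  by exists (Submod wP), y, w.
- move=> q; have [w wq] := eA_surj (val q).
  have [|y yE] := @eB_exact (l _ w).
    by rewrite -lE wq; apply/eqP/(valP q).
  exists (p _ y); first by rewrite -pC yE pl0.
  by exists y, w.
move=> _ q _ [y [w [<- yw wq]]]; split.
  move=> [z' z'E]; have [y' y'E] := p_surj z'.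
  have [|w' w'E] := @pl_exact 1 (y - b 1 y').
    by rewrite linearB pC y'E z'E subrr.
  have wE : w = a 0 w'.
    apply/eqP; rewrite -subr_eq0; apply/eqP/l_inj.
    by rewrite linearB lC w'E linearB bb0 subr0 yw subrr.
  by apply/val_inj; rewrite linear0 -wq wE eAa0.
move=> q0; have [|w' w'E] := @eA_exact w; first by rewrite wq q0 linear0.
have [|y' y'E] := @b_exact 0 (y - l _ w').
  by rewrite linearB -lC w'E yw subrr.
by exists (p _ y'); rewrite -pC y'E linearB pl0 subr0.
Qed.

End Connecting.

Lemma tensor_map_comp0 (R : comNzRingType) (U V W N : lmodType R)
    (f : {linear V -> W}) (g : {linear U -> V}) t :
  (forall u, f (g u) = 0) -> tensor_map N f (tensor_map N g t) = 0.
Proof.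
move=> fg0; have fg : \0 =1 f \o g by move=> u; rewrite /= fg0.
by rewrite -(tensor_map_comp _ fg) tensor_map0.
Qed.

Lemma tensor_mapr_comp0 (R : comNzRingType) (U V W M : lmodType R)
    (f : {linear V -> W}) (g : {linear U -> V}) t :
  (forall u, f (g u) = 0) -> tensor_mapr M f (tensor_mapr M g t) = 0.
Proof.
move=> fg0; have fg : \0 =1 f \o g by move=> u; rewrite /= fg0.
by rewrite -(tensor_mapr_comp _ fg) tensor_mapr0.
Qed.

(** Flatness keeps [v] injective after tensoring, so [p] and [c] have the same kernel there, and
    right exactness applies to [c]. *)
Lemma flat_tensor_exact (R : comNzRingType) (F U V V' W : lmodType R)
    (i : {linear U -> V}) (p : {linear V -> W}) (c : {linear V -> V'})
    (v : {linear V' -> W}) t :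
  flat F -> p =1 v \o c -> (forall y, exists x, c x = y) -> injective v ->
  (forall x, c x = 0 -> exists u, i u = x) ->
  tensor_map F p t = 0 -> exists u, tensor_map F i u = t.
Proof.
move=> flatF pE c_surj v_inj ci pt0.
apply: (tensor_map_exact c_surj ci); apply: (flatF _ _ v v_inj).
by rewrite -(tensor_map_comp _ pE) pt0 linear0.
Qed.

Lemma kernel_val_exact (R : comNzRingType) (U V : lmodType R)
    (f : {linear U -> V}) u :
  f u = 0 -> exists z : submod (kernel f), val z = u.
Proof. by move=> /eqP fu0; exists (Submod (fu0 : u \in kernel f)). Qed.

Lemma corestrict (R : comNzRingType) (U V W : lmodType R)
    (f : {linear U -> V}) (g : {linear V -> W}) :
  (forall u, g (f u) = 0) ->
  exists h : {linear U -> submod (kernel g)}, forall u, val (h u) = f u.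
Proof.
move=> gf0; have fP u : f u \in kernel g by rewrite kernelE gf0.
have [|h hE] := @exists_linear R U _ (fun u => Submod (fP u)).
  by move=> a u v; apply: val_inj; rewrite /= !linearP.
by exists h => u; rewrite hE.
Qed.

(** * Dimension shifting in the second argument of Tor *)

Section FreeResolutionTensor.
Variables (R : comNzRingType) (M : lmodType R).

Local Notation d := (free_res_diff M).
Local Notation cover V := (@free_cover R V : {linear _ -> _}).

Lemma free_res_diff0 i x : d i (d i.+1 x) = 0.
Proof. by apply/free_res_exact; exists x. Qed.

Lemma free_cover_diff0 x : free_cover (d 0 x) = 0.
Proof. by apply/eqP/(valP (free_cover x : syzygy M 1)). Qed.

Lemma syzygy_exact i x :
  free_cover (x : free_res M i) = 0 -> exists y, d i y = x.
Proof.
move=> x0; have xP : x \in kernel (@free_cover R (syzygy M i)).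
  by apply/eqP/x0.
by have [y yE] := free_cover_surj (Submod xP); exists y; rewrite /= yE.
Qed.

Lemma syzygy_tensor_exact (G : lmodType R) i t :
  tensor_map G (cover (syzygy M i)) t = 0 ->
  exists u, tensor_map G (d i) u = t.
Proof.
exact: tensor_map_exact (@free_cover_surj _ _) (@syzygy_exact i).
Qed.

Lemma free_res_tensor_exact (F : lmodType R) i t : flat F ->
  tensor_map F (d i) t = 0 -> exists u, tensor_map F (d i.+1) u = t.
Proof.
move=> flatF; pose v : {linear syzygy M i.+1 -> free_res M i} := val.
have dE : d i =1 v \o cover (syzygy M i.+1) by exact: frefl.
exact: flat_tensor_exact flatF dE (@free_cover_surj _ _) val_inj
  (@syzygy_exact i.+1).
Qed.

Section Shift.
Variables (Z F N : lmodType R) (l : {linear Z -> F}) (p : {linear F -> N}).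
Hypothesis flatF : flat F.
Hypothesis l_inj : injective l.
Hypothesis p_surj : forall n, exists x, p x = n.
Hypothesis pl0 : forall z, p (l z) = 0.
Hypothesis pl_exact : forall x, p x = 0 -> exists z, l z = x.

Let P i := free_res M i.

(** The terms [P i] are free, so 0 -> Z -> F -> N -> 0 stays exact when tensored with them; as [F]
    is flat, the middle complex is acyclic in positive degrees. *)
Lemma Tor_shift j : lmod_isomorphic (Tor j.+2 M N) (Tor j.+1 M Z).
Proof.
apply: (@connecting_iso R (fun i => tensor (P i) Z) (fun i => tensor (P i) F)
  (fun i => tensor (P i) N) (fun i => tensor_map Z (d i))
  (fun i => tensor_map F (d i)) (fun i => tensor_map N (d i))
  (fun i => tensor_mapr (P i) l) (fun i => tensor_mapr (P i) p)) => i t.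
- exact: esym (tensor_map_mapr _ _ _).
- exact: esym (tensor_map_mapr _ _ _).
- exact: freemod_mapr_inj.
- exact: tensor_mapr_surj.
- exact: tensor_mapr_comp0.
- exact: freemod_mapr_exact.
- by apply: tensor_map_comp0 => x; apply: free_res_diff0.
- exact: free_res_tensor_exact.
Qed.

(** The same sequence in lowest degree, with [M (x) Z] and [M (x) F] as the degree 0 homology,
    reached through the free cover of [M]. *)
Lemma Tor1_kernel :
  lmod_isomorphic (Tor 1 M N) (submod (kernel (tensor_mapr M l))).
Proof.
apply: (@connecting_iso0 R (fun i => tensor (P i) Z) (fun i => tensor (P i) F)
  (fun i => tensor (P i) N) (fun i => tensor_map Z (d i))
  (fun i => tensor_map F (d i)) (fun i => tensor_map N (d i))
  (fun i => tensor_mapr (P i) l) (fun i => tensor_mapr (P i) p)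
  _ _ _ _ _ _ _ _ _ _ _
  (tensor_map Z (cover M)) (tensor_map F (cover M))) =>
  [i t|i t|i t|i t|i t|i t|i t|i t|t|t|t|t|t|t].
- exact: esym (tensor_map_mapr _ _ _).
- exact: esym (tensor_map_mapr _ _ _).
- exact: freemod_mapr_inj.
- exact: tensor_mapr_surj.
- exact: tensor_mapr_comp0.
- exact: freemod_mapr_exact.
- by apply: tensor_map_comp0 => x; apply: free_res_diff0.
- exact: free_res_tensor_exact.
- exact: (@tensor_map_surj _ _ _ Z (cover M) (@free_cover_surj _ _)).
- by apply: tensor_map_comp0 => x; apply: free_cover_diff0.
- exact: (@syzygy_tensor_exact Z 0 t).
- by apply: tensor_map_comp0 => x; apply: free_cover_diff0.
- exact: (@syzygy_tensor_exact F 0 t).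
- exact: esym (tensor_map_mapr _ _ _).
Qed.

End Shift.

(** [Z] is the image of [flat_diff F i], known only through the factorization of that differential
    into a surjection [p] and an injection [l]. *)
Lemma Tor_flat_resolution (N : lmodType R) (F : flat_resolution N) i :
  exists (Z : lmodType R) (l : {linear Z -> flat_term F i})
         (p : {linear flat_term F i.+1 -> Z}),
  [/\ injective l, forall z, exists x, p x = z,
      forall x, l (p x) = flat_diff F i x &
      lmod_isomorphic (Tor i.+1 M N) (submod (kernel (tensor_mapr M l)))].
Proof.
elim: i N F => [|i IHi] N F;
  have [p pE] := corestrict
    (fun x => (flat_exact0 (flat_diff F 0 x)).2 (ex_intro _ x erefl));
  pose l : {linear submod (kernel (flat_aug F)) -> flat_term F 0} := val;
  have l_inj : injective l := val_inj;
  have l0 z : flat_aug F (l z) = 0 by [apply: (elimT eqP (valP z))];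
  have p_surj z : exists x, p x = z by [
    have [x xE] := (flat_exact0 (l z)).1 (l0 z);
    exists x; apply: val_inj; rewrite pE].
  exists (submod (kernel (flat_aug F))), l, p; split=> //.
  exact: Tor1_kernel (@flat_termP _ _ F 0) l_inj (@flat_aug_surj _ _ F) l0
    (@kernel_val_exact _ _ _ _).
have p_exact x : p x = 0 <-> exists y, flat_diff F 1 y = x.
  split=> [px0|[y <-]].
    by apply/flat_exactS; rewrite -pE px0 linear0.
  by apply: val_inj; rewrite pE linear0; apply/flat_exactS; exists y.
(* Dropping the term of degree 0 gives a flat resolution of the first syzygy, with [p] as
   augmentation; this is where the induction hypothesis is used. *)
pose F' := @FlatResolution R (submod (kernel (flat_aug F)))
  (fun j => flat_term F j.+1) (fun j => flat_diff F j.+1) p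
  (fun j => @flat_termP _ _ F j.+1) p_surj p_exact
  (fun j => @flat_exactS _ _ F j.+1).
have [Z [l' [p' [l'_inj p'_surj l'p' TZ]]]] := IHi _ F'.
exists Z, l', p'; split=> //; apply: lmod_isomorphic_trans TZ.
exact: Tor_shift (@flat_termP _ _ F 0) l_inj (@flat_aug_surj _ _ F) l0
    (@kernel_val_exact _ _ _ _) i.
Qed.

End FreeResolutionTensor.

(** * Change of rings *)

(** The term of degree [i.+1] is zero, hence so is its quotient [Z], and [Tor i.+1 M N] embeds in
    [M (x) Z]. *)
Lemma Tor_flat_dim (R : comNzRingType) (M N : lmodType R) m i :
  flat_dim_le N m -> (m <= i)%N -> forall q : Tor i.+1 M N, q = 0.
Proof.
move=> [F F0] mi q.
have [Z [l [p [_ p_surj _ [g gB]]]]] := Tor_flat_resolution M F i.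
have Z0 (z : Z) : z = 0 by have [x <-] := p_surj z; rewrite (F0 i.+1 mi x) linear0.
apply: (bij_inj gB); apply: val_inj; rewrite linear0.
elim/tensor_ind: (val (g q)) => [c z|u v -> ->]; last by rewrite addr0.
by rewrite (Z0 z) tens0r.
Qed.

(** * Tor with a residue ring, from a resolution whose differentials reduce to zero *)

Section ScalarExtension.
Variables (R K : comNzRingType) (rho : {rmorphism R -> K}).
Hypothesis rho_surj : forall c, exists r, rho r = c.

Local Notation k := (restrict rho K^o).
Local Notation one := ((1 : K) : k).

Lemma restrict_scale_linearl (W : lmodType K) (w : W) :
  linear (fun c : k => (c : K) *: w : restrict rho W).
Proof.
move=> a c c'.
suff : (rho a * (c : K) + c') *: w = rho a *: ((c : K) *: w) + (c' : K) *: w by [].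
by rewrite scalerDl scalerA.
Qed.

Lemma restrict_scale_linearr (W : lmodType K) (c : K) :
  linear (fun w : restrict rho W => c *: (w : W) : restrict rho W).
Proof.
move=> a w w'.
suff : c *: (rho a *: (w : W) + w') = rho a *: (c *: (w : W)) + c *: (w' : W) by [].
by rewrite scalerDr !scalerA mulrC.
Qed.

(** As [rho] is onto, [c] is a multiple of 1 by some [r], which then crosses the tensor sign. *)
Lemma tens_residue1 (V : lmodType R) (c : k) (v : V) :
  exists r, tens c v = tens one (r *: v) :> tensor k V.
Proof.
have [r rc] := rho_surj c; exists r.
have -> : c = r *: one by rewrite -rc; apply/esym/(mulr1 (rho r : K)).
by rewrite tensZl tensZr.
Qed.

(** [psi] plays the role of the reduction of [flat_term F i.+1] to [k (x) flat_term F i.+1]. Because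
    the differentials reduce to zero, [k (x) l] vanishes and Tor is all of [k (x) Z], which [psi]
    identifies with [W]. *)
Lemma Tor_minimal_resolution (N : lmodType R) (F : flat_resolution N) i
    (W : lmodType K) (psi : {linear flat_term F i.+1 -> restrict rho W}) :
  (forall w, exists x, psi x = w) ->
  (forall x, psi x = 0 ->
    forall (Z : lmodType R) (p : {linear flat_term F i.+1 -> Z}),
    tens one (p x) = 0 :> tensor k Z) ->
  (forall x, psi (flat_diff F i.+1 x) = 0) ->
  (forall x, tens one (flat_diff F i x) = 0 :> tensor k (flat_term F i)) ->
  lmod_isomorphic (Tor i.+1 k N) (restrict rho W).
Proof.
move=> psi_surj psi0 psid d0.
have [Z [l [p [l_inj p_surj lp TZ]]]] := Tor_flat_resolution k F i.
have l0 t : tensor_mapr k l t = 0.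
  apply: (@tensor_ext _ _ _ _ (tensor_mapr k l) \0) => c z /=.
  have [r ->] := tens_residue1 c z; have [x <-] := p_surj (r *: z).
  by rewrite tensor_maprE lp d0.
have [s sK] := choice p_surj.
(* [psi] factors through [Z]: the kernel of [p] is that of [flat_diff F i], hence the image of the
   next differential, on which [psi] vanishes. *)
have psiE x x' : p x = p x' -> psi x = psi x'.
  move=> /(congr1 l); rewrite !lp => /eqP; rewrite -subr_eq0 -linearB.
  move=> /eqP/flat_exactS[y yE]; apply/eqP; rewrite -subr_eq0 -linearB -yE.
  by rewrite psid.
have [z a c c'|c a z z'|h hE] := @tensor_lift R k Z (restrict rho W)
    (fun c z => ((c : K) *: (psi (s z) : W) : restrict rho W)).
- exact: restrict_scale_linearl.
- rewrite (@psiE _ (a *: s z + s z')); last by rewrite linearP !sK.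
  by rewrite linearP; apply: restrict_scale_linearr.
have hp x : h (tens one (p x)) = psi x.
  rewrite hE -(@psiE (s (p x)) x) ?sK //.
  exact: (scale1r (psi (s (p x)) : W)).
have tP (t : tensor k Z) : exists x, t = tens one (p x).
  elim/tensor_ind: t => [c z|u v [x ->] [y ->]].
    by have [r ->] := tens_residue1 c z; have [x <-] := p_surj (r *: z); exists x.
  by exists (x + y); rewrite linearD tensDr.
apply: lmod_isomorphic_trans TZ _.
apply: (@lmod_isomorphic_of _ _ _ (h \o val)) => [t ht|w].
  apply: val_inj; have [x xE] := tP (val t).
  move: ht; rewrite linear0 /= xE hp => px0; exact: psi0 px0 Z p.
have [x <-] := psi_surj w.
have tK : tens one (p x) \in kernel (tensor_mapr k l).
  by rewrite kernelE; apply/eqP/l0.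
by exists (Submod tK); rewrite /= hp.
Qed.

End ScalarExtension.

(** * Flatness over R of free A-modules of finite rank *)

Section FreeRestriction.
Variables (R A : comNzRingType) (phi : {rmorphism R -> A}).
Hypothesis phi_surj : forall a, exists r, phi r = a.

Local Notation free m := (restrict phi 'rV[A]_m).

Lemma restrict_rVE m (v : free m) (r : 'I_m -> R) :
  (forall j, phi (r j) = v 0 j) ->
  v = \sum_j r j *: (delta_mx 0 j : free m).
Proof.
move=> rv; apply: etrans (row_sum_delta v) _.
by apply: eq_bigr => j _; rewrite -rv.
Qed.

(* Given surjectivity, the hypothesis says that A is the localization of R at
   phi^-1(1). *)
Lemma flat_restrict_rV m :
  (forall r, phi r = 0 -> exists2 s, phi s = 1 & s * r = 0) ->
  flat (free m).
Proof.
move=> phi_ker M N f f_inj.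
suff f0 t : tensor_map (free m) f t = 0 -> t = 0.
  move=> t t' /eqP; rewrite -subr_eq0 => /eqP tt'.
  by apply/eqP; rewrite -subr_eq0; apply/eqP/f0; rewrite linearB.
(* The kernel of the localization map of [N] at the elements over 1. On [N / S] the action of [r]
   depends only on [phi r], so [N / S] can receive the coordinates of [N (x) A^m]. *)
pose S : {pred N} := fun n => `[< exists2 s, phi s = 1 & s *: n = 0 >].
have SP n : reflect (exists2 s, phi s = 1 & s *: n = 0) (n \in S).
  exact: asboolP.
have S_closed : submod_closed S.
  split=> [|a n n' /SP[s s1 sn] /SP[s' s'1 s'n]]; apply/SP.
    by exists 1; rewrite ?rmorph1 ?scaler0.
  exists (s * s'); first by rewrite rmorphM s1 s'1 mulr1.
  rewrite scalerDr -[s * s' *: n']scalerA s'n scaler0 addr0 scalerA.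
  by rewrite -mulrA mulrC -scalerA sn scaler0.
pose S' : submodClosed N :=
  HB.pack S (GRing.isSubmodClosed.Build R N S S_closed).
have [s sK] := choice phi_surj.
have piE r r' n : phi r = phi r' ->
    quotmod_pi S' (r *: n) = quotmod_pi S' (r' *: n).
  move=> /eqP; rewrite -subr_eq0 -rmorphB => /eqP/phi_ker[u u1 ur].
  apply/quotmod_piP/SP; exists u => //.
  by rewrite -scalerBl scalerA ur scale0r.
have coord j : exists h : {linear tensor N (free m) -> quotmod S'},
    forall n i, h (tens n (delta_mx 0 i : free m)) =
      quotmod_pi S' ((i == j)%:R *: n).
  have [v a n n'|n a v v'|h hE] := @tensor_lift R N (free m) (quotmod S')
      (fun n v => quotmod_pi S' (s ((v : 'rV_m) 0 j) *: n)).
  - by rewrite -linearP scalerDr !scalerA mulrC.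
  - rewrite -linearP scalerA -scalerDl; apply: piE.
    by rewrite rmorphD rmorphM !sK !mxE.
  exists h => n i; rewrite hE; apply: piE.
  by rewrite sK !mxE eqxx eq_sym rmorph_nat.
have [g gE] : exists g : 'I_m -> M, t = \sum_j tens (g j) (delta_mx 0 j : free m).
  elim/tensor_ind: t => [n v|_ _ [g ->] [g' ->]].
    exists (fun j => s ((v : 'rV_m) 0 j) *: n).
    rewrite [v in LHS](restrict_rVE (fun j => sK _)) tens_sumr.
    by apply: eq_bigr => j _; rewrite tensZl tensZr.
  exists (fun j => g j + g' j); rewrite -big_split.
  by apply: eq_bigr => j _; rewrite tensDl.
rewrite gE linear_sum => ft0; apply: big1 => j _.
have [h hE] := coord j.
have : h 0 = quotmod_pi S' (f (g j)).
  rewrite -ft0 linear_sum (bigD1 j) //= big1 => [|i /negPf ij].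
    by rewrite tensor_mapE hE eqxx scale1r addr0.
  by rewrite tensor_mapE hE ij scale0r linear0.
rewrite linear0 -(linear0 (quotmod_pi S')) => /esym/quotmod_piP.
(* Some [u] over 1 kills [f (g j)], hence [g j] by injectivity of [f]; as [u] acts as 1 on the free
   module, it can be inserted in the right factor and moved to the left. *)
rewrite subr0 => /SP[u u1]; rewrite -linearZ_LR -(linear0 f) => /f_inj ug.
have -> : (delta_mx 0 j : free m) = u *: (delta_mx 0 j : free m).
  suff : delta_mx 0 j = phi u *: delta_mx 0 j :> 'rV_m by [].
  by rewrite u1 scale1r.
by rewrite tensZr -tensZl ug tens0l.
Qed.

(** Lifts to [R] of the coordinates of [v] can be moved to the left factor, where they act on 1
    through [K], that is, by zero. *)
Lemma tens_residue_eq0 (K : comNzRingType) (rho : {rmorphism A -> K}) m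
    (v : free m) (Z : lmodType R) (p : {linear free m -> Z}) :
  map_mx rho v = 0 ->
  tens ((1 : K) : restrict (rho \o phi) K^o) (p v) = 0
    :> tensor (restrict (rho \o phi) K^o) Z.
Proof.
move=> v0; have [r rv] := choice (fun j => phi_surj ((v : 'rV_m) 0 j)).
rewrite (restrict_rVE rv) linear_sum tens_sumr big1 // => j _.
rewrite linearZ_LR tensZr -tensZl.
have -> : r j *: ((1 : K) : restrict (rho \o phi) K^o) = 0.
  suff : rho (phi (r j)) * 1 = 0 by [].
  rewrite mulr1.
  by rewrite rv; move/matrixP/(_ 0 j): v0; rewrite !mxE.
exact: tens0l.
Qed.

End FreeRestriction.

(** * The Koszul complex *)

(** Pascal's recursion is used instead of the binomial coefficient so that the blocks of the Koszul
    matrices have the right sizes by conversion. *)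
Fixpoint koszul_dim (j i : nat) : nat :=
  match j, i with
  | 0, 0 => 1
  | 0, _.+1 => 0
  | j'.+1, 0 => koszul_dim j' 0
  | j'.+1, i'.+1 => koszul_dim j' i'.+1 + koszul_dim j' i'
  end.

Lemma koszul_dimE j i : koszul_dim j i = 'C(j, i).
Proof.
elim: j i => [|j IHj] [|i] //=; first by rewrite IHj !bin0.
by rewrite !IHj binS.
Qed.

Section Koszul.
Variables (A : comNzRingType) (x : nat -> A).

(* The Koszul complex on x_0, ..., x_j is the cone of multiplication by x_j on
   the one on x_0, ..., x_(j-1): d (a, b) = (d a + x_j b, - d b). *)
Fixpoint koszul (j i : nat) : 'M[A]_(koszul_dim j i.+1, koszul_dim j i) :=
  match j return 'M[A]_(koszul_dim j i.+1, koszul_dim j i) with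
  | 0 => 0
  | j'.+1 =>
    match i return 'M[A]_(koszul_dim j'.+1 i.+1, koszul_dim j'.+1 i) with
    | 0 => col_mx (koszul j' 0) (x j')%:M
    | i'.+1 => block_mx (koszul j' i'.+1) 0 (x j')%:M (- koszul j' i')
    end
  end.

Lemma mul_koszul0 j (v : 'rV_(koszul_dim j 1)) (w : 'rV_(koszul_dim j 0)) :
  row_mx v w *m koszul j.+1 0 = v *m koszul j 0 + x j *: w.
Proof. by rewrite /= mul_row_col mul_mx_scalar. Qed.

Lemma mul_koszulS j i (v : 'rV_(koszul_dim j i.+2))
    (w : 'rV_(koszul_dim j i.+1)) :
  row_mx v w *m koszul j.+1 i.+1 =
  row_mx (v *m koszul j i.+1 + x j *: w) (- (w *m koszul j i)).
Proof.
by rewrite /= mul_row_block mul_mx_scalar mulmx0 add0r mulmxN.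
Qed.

Lemma koszul_koszul j i (v : 'rV_(koszul_dim j i.+2)) :
  v *m koszul j i.+1 *m koszul j i = 0.
Proof.
elim: j i v => [|j IHj] i v; first by rewrite mulmx0.
rewrite -[v](@hsubmxK _ _ (koszul_dim j i.+2) (koszul_dim j i.+1)).
rewrite mul_koszulS; case: i v => [|i] v.
  by rewrite mul_koszul0 mulmxDl IHj add0r -scalemxAl scalerN subrr.
rewrite mul_koszulS mulmxDl IHj add0r -scalemxAl scalerN subrr.
by rewrite mulNmx IHj oppr0 oppr0 row_mx0.
Qed.

(** Induction on the number of elements. The hypothesis says that each [x j] is a nonzerodivisor
    modulo the preceding ones, whose ideal is the image of [koszul x j 0]. *)
Lemma koszul_exact m :
  (forall j (u : 'rV_(koszul_dim j 0)), (j < m)%N ->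
    (exists w, x j *: u = w *m koszul j 0) -> exists w, u = w *m koszul j 0) ->
  forall i (v : 'rV_(koszul_dim m i.+1)), v *m koszul m i = 0 ->
  exists w, v = w *m koszul m i.+1.
Proof.
elim: m => [|m IHm] reg i v.
  by exists 0; rewrite mul0mx; apply: thinmx0.
have {}IHm := IHm (fun j u jm => reg j u (ltnW jm)).
rewrite -[v](@hsubmxK _ _ (koszul_dim m i.+1) (koszul_dim m i)).
move: (lsubmx _) (rsubmx _) => {}v v'.
(* A cycle [(v, v')] of the cone has [v'] a boundary, by regularity in lowest degree and by
   induction above. If [v'] is the boundary of [w], then [v + x m *: w] is a cycle of the smaller
   complex. *)
suff : row_mx v v' *m koszul m.+1 i = 0 ->
    v *m koszul m i + x m *: v' = 0 /\ exists w, v' = w *m koszul m i.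
  move=> h /h[vv' [w wE]]; have [|w' w'E] := IHm i (v + x m *: w).
    by rewrite mulmxDl -scalemxAl -wE.
  exists (row_mx w' (- w)); rewrite mul_koszulS -w'E mulNmx opprK -wE.
  by rewrite scalerN addrK.
case: i v v' => [|i] v v'.
  rewrite mul_koszul0 => vv'; split=> //; apply: reg => //; exists (- v).
  by apply/eqP; rewrite mulNmx -addr_eq0 addrC vv'.
rewrite mul_koszulS -row_mx0 => /eq_row_mx[vv' /eqP]; rewrite oppr_eq0.
by move=> /eqP/IHm.
Qed.

Lemma map_koszul_eq0 (K : comNzRingType) (rho : {rmorphism A -> K}) j i :
  (forall l, rho (x l) = 0) -> map_mx rho (koszul j i) = 0.
Proof.
move=> x0; elim: j i => [|j IHj] [|i] /=; rewrite ?map_mx0 //.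
  by rewrite map_col_mx IHj map_scalar_mx x0 raddf0 col_mx0.
rewrite map_block_mx !IHj map_scalar_mx x0 map_mxN IHj map_mx0 oppr0.
by rewrite raddf0 block_mx0.
Qed.

(* koszul_dim j 0 is 1, but not convertibly so. *)
Definition koszul_aug j (u : 'rV[A]_(koszul_dim j 0)) : A := \sum_s u 0 s.

Lemma koszul_aug_is_linear j : linear (@koszul_aug j : _ -> A^o).
Proof.
move=> a u v; rewrite /koszul_aug scaler_sumr -big_split.
by apply: eq_bigr => s _; rewrite !mxE.
Qed.

HB.instance Definition _ j := GRing.isLinear.Build A _ A^o _ (@koszul_aug j)
  (@koszul_aug_is_linear j).

Lemma koszul_aug_inj j : injective (@koszul_aug j).
Proof.
(* [koszul_dim j.+1 0] reduces to [koszul_dim j 0], so the successor case is the induction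
   hypothesis itself. *)
elim: j => [|j IHj]; last exact: IHj.
move=> u v; rewrite /koszul_aug !big_ord1 => uv.
by apply/matrixP => i l; rewrite !ord1.
Qed.

Lemma koszul_aug_surj j a : exists u, @koszul_aug j u = a.
Proof.
elim: j => [|j IHj]; last exact: IHj.
by exists (const_mx a); rewrite /koszul_aug big_ord1 mxE.
Qed.

(** [J j] stands for the ideal generated by the first [j] elements; it is known only by its
    recursion, so that it can be described through monomials later. *)
Lemma koszul_aug_image n (J : nat -> A -> Prop) :
  (forall a, J 0 a <-> a = 0) ->
  (forall j a, (j < n)%N ->
    J j.+1 a <-> exists2 b, J j b & exists c, a = b + x j * c) ->
  forall j u, (j <= n)%N ->
    (exists w, u = w *m koszul j 0) <-> J j (koszul_aug u).
Proof.
move=> J0 JS; elim=> [|j IHj] u jn.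
  split=> [[w ->]|/J0 u0]; first by apply/J0; rewrite mulmx0 linear0.
  by exists 0; rewrite mulmx0; apply: koszul_aug_inj; rewrite u0 linear0.
split=> [[w ->]|/JS].
  rewrite -[w](@hsubmxK _ _ (koszul_dim j 1) (koszul_dim j 0)) mul_koszul0.
  apply/JS => //; exists (koszul_aug (lsubmx w *m koszul j 0)).
    by apply/(IHj _ (ltnW jn)); exists (lsubmx w).
  exists (koszul_aug (rsubmx w : 'rV_(koszul_dim j 0))).
  by rewrite -[LHS]/(@koszul_aug j _) linearD linearZ.
move=> /(_ jn)[b Jb [c uE]].
have [ub ubE] := koszul_aug_surj j b; have [uc ucE] := koszul_aug_surj j c.
have [w wE] : exists w, ub = w *m koszul j 0.
  by apply/(IHj _ (ltnW jn)); rewrite ubE.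
exists (row_mx w uc); rewrite mul_koszul0 -wE.
apply: (@koszul_aug_inj j); rewrite linearD linearZ /= ubE ucE.
exact: uE.
Qed.

End Koszul.

(** * The coordinates as a regular sequence *)

Lemma frac_addM (F : fieldType) (a b c d e : F) : b != 0 -> d != 0 ->
  a / b + e / 1 * (c / d) = (a * d + c * b * e) / (b * d).
Proof.
move=> b0 d0; rewrite divr1 mulrA addf_div //.
by rewrite [e * c]mulrC -[c * e * b]mulrA [e * b]mulrC mulrA.
Qed.

Lemma frac_addM1 (F : fieldType) (a b c e : F) :
  (a + c * e) / b = a / b + e / 1 * (c / b).
Proof. by rewrite divr1 mulrDl mulrA [e * c]mulrC. Qed.

Lemma frac_mulK (F : fieldType) (a b c : F) : c != 0 -> a / b = (a * c) / (b * c).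
Proof. by move=> c0; rewrite -mulf_div divff // mulr1. Qed.

Section CoordinateIdeals.
Variables (k : fieldType) (n : nat).
Implicit Types (f g h : {mpoly k[n]}).

(* The ideal (x_0, ..., x_(j-1)), as a condition on the monomials of f. *)
Definition coord_ideal (j : nat) f : Prop :=
  forall m : 'X_{1..n}, (forall l : 'I_n, (l < j)%N -> m l = 0%N) -> f@_m = 0.

Lemma coord_ideal0 f : coord_ideal 0 f <-> f = 0.
Proof.
by split=> [f0|-> m _]; rewrite ?mcoeff0 //; apply/mpolyP => m; rewrite f0 ?mcoeff0.
Qed.

Lemma coord_ideal_all f : coord_ideal n f <-> f@_0%MM = 0.
Proof.
split=> [f0|f0 m m0]; first by apply: f0 => l _; rewrite mnm0E.
rewrite (_ : m = 0%MM) //; apply/mnmP => l.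
by rewrite m0 ?mnm0E.
Qed.

Lemma coord_idealD j f g :
  coord_ideal j f -> coord_ideal j g -> coord_ideal j (f + g).
Proof. by move=> fj gj m mj; rewrite mcoeffD fj ?gj ?addr0. Qed.

(** A divisor of a monomial free of the first [j] variables is free of them too. *)
Lemma coord_idealM j f g : coord_ideal j f -> coord_ideal j (f * g).
Proof.
move=> fj m mj; rewrite mcoeffM big1 // => -[m1 m2] /= /eqP mE.
rewrite fj ?mul0r // => l lj.
have /eqP := congr1 (fun q : 'X_{1..n} => q l) mE.
by rewrite mj // mnmDE eq_sym addn_eq0 => /andP[/eqP].
Qed.

(** Multiplication by ['X_i] shifts monomials without changing their exponents at the variables
    below [i]. *)
Lemma coord_ideal_regular (i : 'I_n) f :
  coord_ideal i (f * 'X_i) -> coord_ideal i f.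
Proof.
move=> fj m mj; rewrite -(mcoeffMX f U_(i)); apply: fj => l li.
by rewrite mnmDE mnm1E mj // addn0; case: eqP li => // ->; rewrite ltnn.
Qed.

Lemma coord_ideal_mono (i : nat) f : coord_ideal i f -> coord_ideal i.+1 f.
Proof. by move=> fi m mi; apply: fi => l li; apply: mi; apply: ltnW. Qed.

Lemma coord_idealX (i : 'I_n) h : coord_ideal i.+1 (h * 'X_i).
Proof.
rewrite mulrC; apply: coord_idealM => m mi; rewrite mcoeffX.
case: eqP => // mE; have := mi i (ltnSn i).
by rewrite -mE mnm1E eqxx.
Qed.

Lemma coord_idealS (i : 'I_n) f : coord_ideal i.+1 f ->
  exists2 f', coord_ideal i f' & exists h, f = f' + h * 'X_i.
Proof.
move=> fi; rewrite [f]mpolyE big_seq.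
pose Q g := exists2 f', coord_ideal i f' & exists h, g = f' + h * 'X_i.
apply: (@big_ind _ Q) => [|_ _ [f1 f1i [h1 ->]] [f2 f2i [h2 ->]]|m mf].
- by exists 0; [move=> m _; rewrite mcoeff0|exists 0; rewrite mul0r addr0].
- exists (f1 + f2); first exact: coord_idealD.
  by exists (h1 + h2); rewrite mulrDl addrACA.
(* Terms of [f] divisible by ['X_i] go to the multiple of ['X_i]; the others already lie in the
   smaller ideal. *)
have [mi|mi] := eqVneq (m i) 0%N.
  exists (f@_m *: 'X_[m]); last by exists 0; rewrite mul0r addr0.
  move=> m' m'i; rewrite mcoeffZ mcoeffX; case: eqP => [mm'|_];
    last by rewrite mulr0.
  rewrite fi ?mul0r // => l; rewrite ltnS leq_eqVlt => /orP[/eqP/val_inj -> //|li].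
  by rewrite mm' m'i.
exists 0; first by move=> m' _; rewrite mcoeff0.
exists (f@_m *: 'X_[m - U_(i)]); rewrite add0r -scalerAl -mpolyXD submK //.
by apply/mnm_lepP => j; rewrite mnm1E; case: eqP => // <-; rewrite lt0n.
Qed.

(** * Coordinate ideals in the localization *)

Local Notation A := (A_ k n).
Local Notation O := (@origin_ideal k n).
Local Notation "x %:F" := (@tofrac {mpoly k[n]} x) (format "x %:F").

Lemma loc_valD (a b : A) : loc_val (a + b) = loc_val a + loc_val b.
Proof. exact: (rmorphD (val : A -> _)). Qed.

Lemma loc_valM (a b : A) : loc_val (a * b) = loc_val a * loc_val b.
Proof. exact: (rmorphM (val : A -> _)). Qed.

Fact A_poly_subproof f : f%:F \in loc_pred O.
Proof. by apply/asboolP; exists f, 1; rewrite idealr1 tofrac1 divr1. Qed.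

Definition A_poly f : A := Loc (A_poly_subproof f).

(** Indexed by all naturals, as [koszul] expects; the default 0 keeps every [coord j] in the maximal
    ideal. *)
Definition coord (j : nat) : A :=
  if insub j is Some i then A_poly 'X_i else 0.

Lemma coordE (i : 'I_n) : loc_val (coord i) = ('X_i)%:F / 1%:F.
Proof. by rewrite /coord valK tofrac1 divr1. Qed.

Lemma coord_reduce j : A_reduce (coord j) = 0.
Proof.
rewrite /coord; case: insubP => [i _ ij|_]; last exact: rmorph0.
rewrite (@A_reduceE k n _ 'X_i 1) ?idealr1 //; last by rewrite tofrac1 divr1.
by rewrite mcoeffX (_ : (U_(i) == 0)%MM = false) ?mul0r // mnm1_eq0.
Qed.

Definition A_coord_ideal (j : nat) (a : A) : Prop :=
  exists f g, [/\ g \notin O, coord_ideal j f & loc_val a = f%:F / g%:F].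

Lemma A_coord_ideal0 a : A_coord_ideal 0 a <-> a = 0.
Proof.
split=> [[f [g [_ /coord_ideal0 -> aE]]]|->].
  by apply: val_inj; rewrite [LHS]aE tofrac0 mul0r.
exists 0, 1; split; rewrite ?idealr1 //; first by apply/coord_ideal0.
by rewrite tofrac0 mul0r.
Qed.

Lemma A_coord_ideal_all a : A_coord_ideal n a <-> A_reduce a = 0.
Proof.
split=> [[f [g [gO /coord_ideal_all f0 aE]]]|].
  by rewrite (A_reduceE gO aE) f0 mul0r.
have [[f g] /= [gO aE]] := A_fracP a; rewrite (A_reduceE gO aE) => /eqP.
rewrite mulf_eq0 invr_eq0 -[g@_0%MM == 0]origin_idealE (negPf gO) orbF.
by move=> /eqP f0; exists f, g; split=> //; apply/coord_ideal_all.
Qed.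

Lemma A_coord_idealS j a : (j < n)%N ->
  A_coord_ideal j.+1 a <->
  exists2 b, A_coord_ideal j b & exists c, a = b + coord j * c.
Proof.
move=> jn; pose i := Ordinal jn; split.
  move=> [f [g [gO fi aE]]].
  have [f' f'i [h fE]] := @coord_idealS i f fi.
  have frac_loc e : e%:F / g%:F \in loc_pred O by apply/asboolP; exists e, g.
  exists (Loc (frac_loc f')); first by exists f', g.
  exists (Loc (frac_loc h)); apply: val_inj.
  apply: (etrans aE); rewrite fE tofracD tofracM frac_addM1.
  apply: esym; apply: (etrans (loc_valD _ _)); congr (_ + _).
  by apply: (etrans (loc_valM _ _)); rewrite (coordE i) tofrac1.
move=> [b [f [g [gO fj bE]]] [c ->]].
have [[f' g'] /= [g'O cE]] := A_fracP c.
exists (f * g' + (f' * g) * 'X_i), (g * g'); split; first exact: notin_primeM.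
  apply: coord_idealD; last exact: (@coord_idealX i).
  exact/coord_ideal_mono/coord_idealM.
rewrite loc_valD loc_valM bE cE (coordE i) tofrac1.
have g0 := notin_prime_neq0 gO; have g'0 := notin_prime_neq0 g'O.
by rewrite (frac_addM _ _ _ g0 g'0) tofracD !tofracM.
Qed.

Lemma A_coord_ideal_regular j a : (j < n)%N ->
  A_coord_ideal j (coord j * a) -> A_coord_ideal j a.
Proof.
move=> jn [f [g [gO fj]]]; pose i := Ordinal jn.
have [[f' g'] /= [g'O aE]] := A_fracP a.
move=> /(etrans (esym (loc_valM _ _))).
rewrite (coordE i) aE loc_fracM mul1r.
move=> /(loc_frac_eq g'O gO) E.
(* [E] places ['X_i * f' * g] in the ideal, hence [f' * g] by regularity; so [a] is rewritten with
   [f' * g] as numerator. *)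
exists (f' * g), (g' * g); split; first exact: notin_primeM.
  apply: (@coord_ideal_regular i); rewrite mulrAC [f' * _]mulrC E.
  exact: coord_idealM.
by rewrite aE !tofracM; apply: (frac_mulK _ _ (notin_prime_neq0 gO)).
Qed.

End CoordinateIdeals.

(** * The Koszul resolution over the ring T(A) *)

Lemma T_fst_surj (A : localRing) (a : A) : exists r : T A, T_fst A r = a.
Proof.
have aT : (a, fun=> residue A a) \in @T_pred A.
  apply/asboolP; rewrite (_ : [set i | _]%classic = set0) //.
  by apply/seteqP; split=> i.
by exists (MkT aT).
Qed.

Lemma T_fst_ker (A : localRing) (r : T A) :
  T_fst A r = 0 -> exists2 s : T A, T_fst A s = 1 & s * r = 0.
Proof.
case: r => -[a c] rT; rewrite [T_fst _ _]/= => a0.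
have /asboolP /= fin_c := rT.
(* The indicator of the zeros of [c]: it differs from 1 only on the support of [c], which is finite
   because [a] is 0. *)
have sT : (1, fun i => (c i == 0)%:R) \in @T_pred A.
  apply/asboolP; apply: sub_finite_set fin_c => i /=.
  by rewrite a0 rmorph0 rmorph1; case: eqP.
exists (MkT sT) => //; apply: val_inj.
suff E i : (c i == 0)%:R * c i = 0.
  by congr pair; [exact: etrans (mul1r a) a0|apply/funext => i; exact: E].
by case: eqP => [->|_]; [exact: mulr0|exact: mul0r].
Qed.

Lemma linear_restrict (R S : comNzRingType) (phi : {rmorphism R -> S})
    (V W : lmodType S) (f : {linear V -> W}) :
  linear (f : restrict phi V -> restrict phi W).
Proof. by move=> a u v; apply: (linearP f). Qed.

Section KoszulResolution.
Variables (R A K : comNzRingType).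
Variables (phi : {rmorphism R -> A}) (rho : {rmorphism A -> K}).
Variables (x : nat -> A) (n : nat).

Hypothesis phi_surj : forall a, exists r, phi r = a.
Hypothesis phi_ker : forall r, phi r = 0 -> exists2 s, phi s = 1 & s * r = 0.
Hypothesis rho_surj : forall c, exists a, rho a = c.
Hypothesis rho_x : forall j, rho (x j) = 0.
Hypothesis x_regular : forall j (u : 'rV_(koszul_dim j 0)), (j < n)%N ->
  (exists w, x j *: u = w *m koszul x j 0) -> exists w, u = w *m koszul x j 0.
Hypothesis x_image : forall u : 'rV_(koszul_dim n 0),
  (exists w, u = w *m koszul x n 0) <-> rho (koszul_aug u) = 0.

Local Notation F i := (restrict phi 'rV[A]_(koszul_dim n i)).
Local Notation k := (restrict (rho \o phi) K^o).

Fact koszul_diff_ex i : exists d : {linear F i.+1 -> F i},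
  forall v, d v = (v : 'rV_(koszul_dim n i.+1)) *m koszul x n i.
Proof. exact/exists_linear/(linear_restrict (mulmxr (koszul x n i))). Qed.

Definition koszul_diff i := projT1 (cid (koszul_diff_ex i)).

Lemma koszul_diffE i (v : 'rV_(koszul_dim n i.+1)) :
  koszul_diff i v = v *m koszul x n i.
Proof. by rewrite /koszul_diff; case: cid. Qed.

Fact koszul_eps_ex : exists e : {linear F 0 -> k},
  forall v, e v = rho (koszul_aug (v : 'rV_(koszul_dim n 0))).
Proof.
apply: exists_linear => a u v.
rewrite [koszul_aug _](koszul_aug_is_linear (phi a) u v) rmorphD.
by congr (_ + _); apply: rmorphM.
Qed.

Definition koszul_eps := projT1 (cid koszul_eps_ex).

Lemma koszul_epsE (v : 'rV_(koszul_dim n 0)) :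
  koszul_eps v = rho (koszul_aug v).
Proof. by rewrite /koszul_eps; case: cid. Qed.

Lemma koszul_eps_surj (c : k) : exists v, koszul_eps v = c.
Proof.
have [a <-] := rho_surj c; have [v <-] := koszul_aug_surj n a.
by exists v; rewrite koszul_epsE.
Qed.

Lemma koszul_eps_exact v :
  koszul_eps v = 0 <-> exists w, koszul_diff 0 w = v.
Proof.
rewrite koszul_epsE; split=> [/x_image[w vE]|[w <-]].
  by exists w; rewrite koszul_diffE vE.
by apply/x_image; exists w; rewrite koszul_diffE.
Qed.

Lemma koszul_diff_exact i v :
  koszul_diff i v = 0 <-> exists w, koszul_diff i.+1 w = v.
Proof.
rewrite koszul_diffE; split=> [/(koszul_exact x_regular)[w vE]|[w <-]].
  by exists w; rewrite koszul_diffE vE.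
by rewrite koszul_diffE; apply: koszul_koszul.
Qed.

Definition koszul_resolution : flat_resolution k :=
  FlatResolution
    (fun i => @flat_restrict_rV _ _ _ phi_surj (koszul_dim n i) phi_ker)
    koszul_eps_surj koszul_eps_exact koszul_diff_exact.

Lemma koszul_flat_dim : flat_dim_le k n.
Proof.
exists koszul_resolution => i ni v; apply/matrixP => r s.
by exfalso; case: s => s; rewrite koszul_dimE bin_small.
Qed.

Fact koszul_residue_ex i :
  exists psi : {linear F i -> restrict (rho \o phi) 'rV[K]_(koszul_dim n i)},
    forall v, psi v = map_mx rho (v : 'rV_(koszul_dim n i)).
Proof.
apply: exists_linear => a u v; apply/matrixP => r s.
suff : rho (phi a * (u : 'M_(_, _)) r s + (v : 'M_(_, _)) r s) =
    rho (phi a) * rho ((u : 'M_(_, _)) r s) + rho ((v : 'M_(_, _)) r s).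
  by rewrite !mxE.
by rewrite rmorphD rmorphM.
Qed.

(** Coordinatewise reduction serves as [psi]; the Koszul matrices reduce to zero because every [x j]
    does. *)
Lemma Tor_koszul i :
  lmod_isomorphic (Tor i.+1 k k)
    (restrict (rho \o phi) 'rV[K]_(koszul_dim n i.+1)).
Proof.
have [psi psiE] := koszul_residue_ex i.+1.
have d_residue j (v : 'rV_(koszul_dim n j.+1)) :
    map_mx rho (koszul_diff j v : 'rV_(koszul_dim n j)) = 0.
  by rewrite koszul_diffE map_mxM map_koszul_eq0 ?mulmx0.
have rho_phi_surj c : exists r, (rho \o phi) r = c.
  have [a <-] := rho_surj c; have [r <-] := phi_surj a; by exists r.
apply: (@Tor_minimal_resolution R K (rho \o phi) rho_phi_surj k
  koszul_resolution i _ psi).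
- move=> w; have [f fE] := choice (fun s => rho_surj ((w : 'rV_(_)) 0 s)).
  exists (\row_s f s); rewrite psiE; apply/matrixP => r s.
  by rewrite !mxE fE ord1.
- by move=> v; rewrite psiE => v0 Z p; apply: tens_residue_eq0.
- by move=> v; rewrite psiE; apply: d_residue.
(* Taking the identity for [p] gives the vanishing in the tensor product with the Koszul term
   itself. *)
move=> v; apply: (@tens_residue_eq0 _ _ _ phi_surj _ rho _ _ _ idfun).
exact: d_residue.
Qed.

End KoszulResolution.

(** * The coordinates of A_n and Tor over R_n *)

Section PolynomialKoszul.
Variables (k : fieldType) (n : nat).

Let A := A_ k n.
Let x : nat -> A := @coord k n.

Lemma coord_image j (u : 'rV[A]_(koszul_dim j 0)) : (j <= n)%N ->
  (exists w, u = w *m koszul x j 0) <-> A_coord_ideal j (koszul_aug u).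
Proof.
move=> jn; apply: (koszul_aug_image (n := n) (J := @A_coord_ideal k n)) jn.
  exact: A_coord_ideal0.
exact: A_coord_idealS.
Qed.

Lemma coord_regular j (u : 'rV[A]_(koszul_dim j 0)) : (j < n)%N ->
  (exists w, x j *: u = w *m koszul x j 0) -> exists w, u = w *m koszul x j 0.
Proof.
move=> jn /(coord_image _ (ltnW jn)).
have -> : koszul_aug (x j *: u) = x j * koszul_aug u.
  exact: linearZ_LR (@koszul_aug A j) (x j) u.
by move=> /(A_coord_ideal_regular jn)/(coord_image _ (ltnW jn)).
Qed.

Lemma coord_image_all (u : 'rV[A]_(koszul_dim n 0)) :
  (exists w, u = w *m koszul x n 0) <-> A_reduce (koszul_aug u) = 0.
Proof.
exact: iff_trans (coord_image u (leqnn n)) (A_coord_ideal_all _).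
Qed.

Lemma Tor_R_k i :
  lmod_isomorphic (Tor i.+1 (R_k k n) (R_k k n)) (R_kvec k n 'C(n, i.+1)).
Proof.
rewrite -koszul_dimE.
exact: (@Tor_koszul (R_ k n) A k (@T_fst A) (@A_reduce k n) x n
  (@T_fst_surj A) (@T_fst_ker A) (@A_reduce_surj k n) (@coord_reduce k n)
  coord_regular coord_image_all i).
Qed.

Lemma flat_dim_le_R_k : flat_dim_le (R_k k n) n.
Proof.
exact: (@koszul_flat_dim (R_ k n) A k (@T_fst A) (@A_reduce k n) x n
  (@T_fst_surj A) (@T_fst_ker A) (@A_reduce_surj k n)
  coord_regular coord_image_all).
Qed.

End PolynomialKoszul.

Theorem corollary7p3 (k : fieldType) (n : nat) (hn : (1 <= n)%N) :
  (forall i : nat, (1 <= i <= n)%N ->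
     lmod_isomorphic (Tor i (R_k k n) (R_k k n)) (R_kvec k n 'C(n, i)))
  /\ flat_dim_eq (R_k k n) n.
Proof.
split=> [[|i] // _|]; first exact: Tor_R_k.
split=> [|m dim_m]; first exact: flat_dim_le_R_k.
rewrite leqNgt; apply/negP => mn.
(* With [n] a successor, [m < n'.+1] is the bound [m <= n'] that makes [Tor n'.+1] vanish, whereas
   it is isomorphic to a space of dimension ['C(n, n) = 1]. *)
case: n hn dim_m mn => // n' _ dim_m mn.
have [f [g _ gK]] := Tor_R_k k n'.+1 n'.
have w0 (w : R_kvec k n'.+1 'C(n'.+1, n'.+1)) : w = 0.
  by rewrite -[w]gK (Tor_flat_dim dim_m mn (g w)) linear0.
have bin_gt : (0 < 'C(n'.+1, n'.+1))%N by rewrite binn.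
have /matrixP/(_ 0 (Ordinal bin_gt))/eqP := w0 (const_mx 1).
by rewrite !mxE oner_eq0.
Qed.
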